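(* Let $R$ be a Noetherian integral domain and let $$f=x_0+x_1t+\cdots+x_mt^m\quad\text{and}\quad g=y_0+y_1t+\cdots+y_nt^n$$ be generic polynomials of degrees $m$ and $n$ over $R$. Then, as ideals of $S=R[x_0,\ldots,x_m,y_0,\ldots,y_n]$, the Gaussian ideal $G(f,g)=c(fg)$ has a primary decomposition $$c(fg)=c(f)\cap c(g)\cap\bigl[c(fg)+c(f)^{n+1}+c(g)^{m+1}\bigr].$$ Furthermore, if $R$ is a Gorenstein ring, then $$L(f,g)=c(fg)+c(f)^{n+1}+c(g)^{m+1}$$ is a Gorenstein ideal of $S$.
   Context: ''Generic polynomials over $R$'' means that $x_0,\ldots,x_m,y_0,\ldots,y_n$ are distinct indeterminates over $R$, so that $f,g\in S[t]$ with $S=R[x_0,\ldots,x_m,y_0,\ldots,y_n]$. For a polynomial $F\in S[t]$, the content $c(F)$ is the ideal of $S$ generated by the coefficients of $F$. An ideal $L$ of the Gorenstein ring $S$ is called a Gorenstein ideal when $S/L$ is a Gorenstein ring. *)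

(* Defs.v *)
From HB Require Import structures.
From mathcomp Require Import all_boot all_order all_algebra.
From mathcomp Require Import generic_quotient ring_quotient.
From mathcomp Require Import boolp classical_sets.
From mathcomp Require Import mpoly ring.

Set Implicit Arguments.
Unset Strict Implicit.
Unset Printing Implicit Defensive.

Import GRing.Theory.

Local Open Scope classical_set_scope.
Local Open Scope ring_scope.
Local Open Scope quotient_scope.

Section Ideals.
Variable A : comNzRingType.
Implicit Types (I J G : set A) (F : {poly A}).

Definition is_ideal I : Prop :=
  [/\ I 0, forall x y, I x -> I y -> I (x + y) & forall a x, I x -> I (a * x)].

Definition ideal_gen G : set A := smallest is_ideal G.

Definition ideal_add I J : set A := [set x + y | x in I & y in J].

Definition ideal_mul I J : set A := ideal_gen [set x * y | x in I & y in J].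

Definition ideal_exp I (k : nat) : set A := iter k (ideal_mul I) setT.

Definition content F : set A := ideal_gen [set F`_i | i in @setT nat].

Definition primary_ideal I : Prop :=
  [/\ is_ideal I, ~ I 1
    & forall a b, I (a * b) -> I a \/ exists k : nat, I (b ^+ k)].

Definition noetherian : Prop :=
  forall I, is_ideal I -> exists s : seq A, I = ideal_gen [set x | x \in s].

End Ideals.

Section Localization.
Variables (A : comNzRingType) (p : prime_idealr A).

Definition loc_den : Type := {s : A | s \notin p}.

Lemma loc_den1_subproof : 1 \notin p.
Proof. by rewrite idealr1. Qed.

Lemma loc_denM_subproof (s t : loc_den) : sval s * sval t \notin p.
Proof. by rewrite prime_idealrM negb_or (svalP s) (svalP t). Qed.

Definition loc_den1 : loc_den := exist _ 1 loc_den1_subproof.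
Definition loc_denM (s t : loc_den) : loc_den :=
  exist _ (sval s * sval t) (loc_denM_subproof s t).

Definition loc_pre : Type := (A * loc_den)%type.
Implicit Types x y z : loc_pre.

(* The factor u is needed because A may have zero divisors. *)
Definition loc_equiv x y : bool :=
  `[< exists2 u, u \notin p & u * (x.1 * sval y.2) = u * (y.1 * sval x.2) >].

Lemma loc_equivP x y :
  reflect (exists2 u, u \notin p & u * (x.1 * sval y.2) = u * (y.1 * sval x.2))
          (loc_equiv x y).
Proof. exact: asboolP. Qed.

Lemma loc_equiv_is_equiv : equiv_class_of loc_equiv.
Proof.
split=> [x|x y|y x z].
- by apply/loc_equivP; exists 1; first exact: loc_den1_subproof.
- by apply/loc_equivP/loc_equivP => -[u pu e]; exists u.
- move=> /loc_equivP[u pu eu] /loc_equivP[v pv ev].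
  apply/loc_equivP; exists (u * v * sval y.2).
    by rewrite !prime_idealrM !negb_or pu pv (svalP y.2).
  transitivity (v * sval z.2 * (u * (x.1 * sval y.2))); first by ring.
  rewrite eu.
  transitivity (u * sval x.2 * (v * (y.1 * sval z.2))); first by ring.
  by rewrite ev; ring.
Qed.

Canonical loc_equivRel := EquivRelPack loc_equiv_is_equiv.
Canonical loc_encModRel := defaultEncModRel loc_equiv.

Definition loc : Type := {eq_quot loc_equiv}.
HB.instance Definition _ : EqQuotient _ loc_equiv loc := EqQuotient.on loc.
HB.instance Definition _ := Choice.on loc.


Lemma loc_pre_repr x : exists2 u, u \notin p &
  u * (x.1 * sval (repr (\pi_loc x)).2) = u * ((repr (\pi_loc x)).1 * sval x.2).
Proof.
have /eqmodP/loc_equivP[u pu e] : \pi_loc (repr (\pi_loc x)) = \pi_loc x.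
  by rewrite reprK.
by exists u.
Qed.

Lemma loc_pre_eq x y : x.1 * sval y.2 = y.1 * sval x.2 -> \pi_loc x = \pi_loc y.
Proof.
move=> e; apply/eqmodP/loc_equivP.
by exists 1; rewrite ?e //; exact: loc_den1_subproof.
Qed.

Definition loc_pre0 : loc_pre := (0, loc_den1).
Definition loc_pre1 : loc_pre := (1, loc_den1).
Definition loc_preN x : loc_pre := (- x.1, x.2).
Definition loc_preD x y : loc_pre :=
  (x.1 * sval y.2 + y.1 * sval x.2, loc_denM x.2 y.2).
Definition loc_preM x y : loc_pre := (x.1 * y.1, loc_denM x.2 y.2).

Definition loc0 : loc := lift_cst loc loc_pre0.
Definition loc1 : loc := lift_cst loc loc_pre1.
Definition locN := lift_op1 loc loc_preN.
Definition locD := lift_op2 loc loc_preD.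
Definition locM := lift_op2 loc loc_preM.

Canonical pi_loc0_morph := PiConst loc0.
Canonical pi_loc1_morph := PiConst loc1.

Lemma pi_locN : {morph \pi : x / loc_preN x >-> locN x}.
Proof.
move=> x; unlock locN; apply/eqmodP/loc_equivP.
by have [u pu e] := loc_pre_repr x; exists u; rewrite //= !mulNr !mulrN e.
Qed.
Canonical pi_locN_morph := PiMorph1 pi_locN.

Lemma pi_locD : {morph \pi : x y / loc_preD x y >-> locD x y}.
Proof.
move=> x y; unlock locD; apply/eqmodP/loc_equivP.
have [u pu eu] := loc_pre_repr x; have [v pv ev] := loc_pre_repr y.
exists (u * v); first by rewrite prime_idealrM negb_or pu.
move: (repr _) (repr _) eu ev => y' x' eu ev /=.
transitivity (u * (x.1 * sval x'.2) * (v * sval y.2 * sval y'.2)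
              + v * (y.1 * sval y'.2) * (u * sval x.2 * sval x'.2)).
  by ring.
by rewrite eu ev; ring.
Qed.
Canonical pi_locD_morph := PiMorph2 pi_locD.

Lemma pi_locM : {morph \pi : x y / loc_preM x y >-> locM x y}.
Proof.
move=> x y; unlock locM; apply/eqmodP/loc_equivP.
have [u pu eu] := loc_pre_repr x; have [v pv ev] := loc_pre_repr y.
exists (u * v); first by rewrite prime_idealrM negb_or pu.
move: (repr _) (repr _) eu ev => y' x' eu ev /=.
transitivity (u * (x.1 * sval x'.2) * (v * (y.1 * sval y'.2))); first by ring.
by rewrite eu ev; ring.
Qed.
Canonical pi_locM_morph := PiMorph2 pi_locM.

Lemma locDA : associative locD.
Proof.
by elim/quotW=> x; elim/quotW=> y; elim/quotW=> z; rewrite !piE;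
  apply: loc_pre_eq => /=; ring.
Qed.

Lemma locDC : commutative locD.
Proof.
by elim/quotW=> x; elim/quotW=> y; rewrite !piE; apply: loc_pre_eq => /=; ring.
Qed.

Lemma loc0D : left_id loc0 locD.
Proof. by elim/quotW=> x; rewrite !piE; apply: loc_pre_eq => /=; ring. Qed.

Lemma locND : left_inverse loc0 locN locD.
Proof. by elim/quotW=> x; rewrite !piE; apply: loc_pre_eq => /=; ring. Qed.

HB.instance Definition _ := GRing.isZmodule.Build loc locDA locDC loc0D locND.

Lemma locMA : associative locM.
Proof.
by elim/quotW=> x; elim/quotW=> y; elim/quotW=> z; rewrite !piE;
  apply: loc_pre_eq => /=; ring.
Qed.

Lemma locMC : commutative locM.
Proof.
by elim/quotW=> x; elim/quotW=> y; rewrite !piE; apply: loc_pre_eq => /=; ring.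
Qed.

Lemma loc1M : left_id loc1 locM.
Proof. by elim/quotW=> x; rewrite !piE; apply: loc_pre_eq => /=; ring. Qed.

Lemma locMDl : left_distributive locM locD.
Proof.
by elim/quotW=> x; elim/quotW=> y; elim/quotW=> z; rewrite !piE;
  apply: loc_pre_eq => /=; ring.
Qed.

Lemma loc1_neq0 : loc1 != loc0.
Proof.
rewrite !piE; apply/negP => /loc_equivP[u pu] /=.
by rewrite !mulr1 mulr0 => u0; move: pu; rewrite u0 idealr0.
Qed.

HB.instance Definition _ :=
  GRing.Zmodule_isComNzRing.Build loc locMA locMC loc1M locMDl loc1_neq0.

End Localization.

Section Homological.
Variable B : comNzRingType.

Definition injective_module (E : lmodType B) : Prop :=
  forall (M N : lmodType B) (i : {linear M -> N}) (h : {linear M -> E}),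
    injective i -> exists g : {linear N -> E}, forall x, g (i x) = h x.

(* There is a finite injective resolution
   0 -> M -> E 0 -> ... -> E n -> 0 -> 0 -> ...  *)
Definition finite_injective_dimension (M : lmodType B) : Prop :=
  exists (n : nat) (E : nat -> lmodType B) (e : {linear M -> E 0%N})
         (d : forall k : nat, {linear E k -> E k.+1}),
    [/\ forall k, injective_module (E k),
        forall k, (n < k)%N -> forall y : E k, y = 0,
        injective e,
        forall y, d 0%N y = 0 <-> exists x, e x = y
      & forall k y, d k.+1 y = 0 <-> exists x, d k x = y].

End Homological.

Definition gorenstein_ring (A : comNzRingType) : Prop :=
  noetherian A /\
  forall p : prime_idealr A, finite_injective_dimension (loc p)^o.

(* Ideals are Prop-valued sets, whereas ideal quotients are by bool-valued
   predicates carrying an idealr structure (which are proper by definition). *)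
Definition gorenstein_ideal (A : comNzRingType) (L : set A) : Prop :=
  exists2 I : idealr A, L = [set x | x \in I] & gorenstein_ring {ideal_quot I}.

Section GenericPolynomials.
Variables (R : comNzRingType) (m n : nat).

Definition generic_ring : comNzRingType := {mpoly R[m.+1 + n.+1]}.

Definition generic_f : {poly generic_ring} :=
  \sum_(i < m.+1) ('X_(lshift n.+1 i) : {mpoly R[m.+1 + n.+1]}) *: 'X^i.

Definition generic_g : {poly generic_ring} :=
  \sum_(j < n.+1) ('X_(rshift m.+1 j) : {mpoly R[m.+1 + n.+1]}) *: 'X^j.

End GenericPolynomials.

(* Main.v *)
Require Import Defs.
From HB Require Import structures.
From mathcomp Require Import all_boot all_order all_algebra.
From mathcomp Require Import boolp classical_sets.
From mathcomp Require Import perm generic_quotient ring_quotient mpoly zify ring.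

(* Write x_I, y_J for the monomials x_i1 ... x_ia and y_j1 ... y_jb, and let
   [res_form] be the R-linear form on S which sends x_I y_J, with |I| = n and
   |J| = m, to the coefficient of t^I s^J in \prod_(i, j) (t_i - s_j), and the
   other monomials to 0. It kills L because t_i - s_j vanishes at t_i = s_j.

   In bidegree (a, b) with a <= n and b <= m, a Vandermonde argument (the one
   behind the Dedekind-Mertens lemma) rewrites every monomial modulo c(fg) into
   those with x-indices >= b and y-indices <= n - a. They correspond to Young
   diagrams, and pairing them through [res_form] with monomials of the
   complementary bidegree gives a unitriangular matrix. Hence S/L is free of
   finite rank over R, with a perfect pairing (F, G) |-> res_form (F * G), and L
   is the annihilator of [res_form]. As (x, y) is nilpotent modulo L, this makes
   L primary over a domain. The intersection formula is Dedekind-Mertens.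

   The pairing makes the localization B of S/L at a prime a Frobenius extension
   of the localization C of R at the contracted prime, so Hom_C(B, -) carries an
   injective resolution of C to one of Hom_C(B, C) = B. *)

Set Implicit Arguments.
Unset Strict Implicit.
Unset Printing Implicit Defensive.

Import Order.TTheory GRing.Theory Num.Theory.

Local Open Scope classical_set_scope.
Local Open Scope ring_scope.

(** * The Dedekind-Mertens lemma *)

(** The exponents [n.+1] and [m.+1] in L come from the resultant, which has degree [n] in the [x_i]
    and [m] in the [y_j]: they leave only the bidegrees that have a complementary one in the
    pairing. Straightening yields generators of S/L but no independence; the latter comes from the
    pairing, because one Young diagram encodes both a standard monomial and a test monomial of
    complementary bidegree. Straightening is done modulo a mere additive subgroup, since it is
    applied to the set of [F] with [L (F - duals D F)], which is not an ideal a priori. The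
    Gorenstein condition concerns localizations of S/L, whereas the hypothesis controls only those
    of R. Nilpotency of (x, y) bridges the gap: every denominator outside a prime of S/L divides an
    element of R outside it, so localizing S/L amounts to inverting elements of R, and the pairing
    survives. *)

Definition is_subgroup (M : zmodType) (W : M -> Prop) : Prop :=
  W 0 /\ forall x y, W x -> W y -> W (x - y).

Section Subgroup.
Variables (M : zmodType) (W : M -> Prop).
Hypothesis WG : is_subgroup W.

Lemma subgroup0 : W 0. Proof. exact: (proj1 WG). Qed.
Lemma subgroupB x y : W x -> W y -> W (x - y). Proof. exact: (proj2 WG). Qed.
Lemma subgroupN x : W x -> W (- x).
Proof. by move=> Wx; rewrite -sub0r; apply: subgroupB => //; exact: subgroup0. Qed.
Lemma subgroupD x y : W x -> W y -> W (x + y).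
Proof. by move=> Wx Wy; rewrite -[y]opprK; apply: subgroupB => //; exact: subgroupN. Qed.
Lemma subgroupDr x y : W y -> W (x + y) -> W x.
Proof. by move=> Wy Wxy; rewrite -(addrK y x); exact: subgroupB. Qed.
Lemma subgroup_sum (I : Type) (r : seq I) (P : pred I) (F : I -> M) :
  (forall i, P i -> W (F i)) -> W (\sum_(i <- r | P i) F i).
Proof. by move=> H; apply: big_ind => //; [exact: subgroup0|exact: subgroupD]. Qed.
End Subgroup.

Section Shift.
Variables (M D : zmodType) (W : M -> Prop).
Hypothesis WG : is_subgroup W.
Variable d : nat -> D.

(** The finiteness that permits cancelling a difference of shifts. In the application [d l] is the
    [l]-th unit vector: far along [d k - d l] the [l]-th index is negative, where coefficients are
    0. *)
Definition eventually_in (c : nat) (u : D -> M) : Prop :=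
  forall J k l, (k < c)%N -> (l < c)%N -> k != l ->
    exists q, forall q', (q <= q')%N -> W (u (J + (d k - d l) *+ q')).

Lemma eventually_in_sum c (r : seq nat) (P : pred nat) (u : nat -> D -> M)
    (s : nat -> D) :
  (forall i, eventually_in c (u i)) ->
  eventually_in c (fun J => \sum_(i <- r | P i) u i (J - s i)).
Proof.
move=> Hu J k l kc lc kl; elim: r => [|i r [q Hq]].
  by exists 0%N => q' _; rewrite big_nil; exact: subgroup0.
have [q1 Hq1] := Hu i (J - s i) k l kc lc kl.
exists (maxn q q1) => q'; rewrite geq_max => /andP[h1 h2].
rewrite big_cons; case: ifP => _; last exact: Hq.
apply: subgroupD => //; last exact: Hq.
by rewrite addrAC; exact: Hq1.
Qed.

(** Modulo [W], [v] is invariant under translation by [d k - d l], and far along this direction it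
    lies in [W]. *)
Lemma shift_injective c (v : D -> M) k l :
  (k < c)%N -> (l < c)%N -> k != l -> eventually_in c v ->
  (forall J, W (v (J - d k) - v (J - d l))) -> forall J, W (v J).
Proof.
move=> kc lc kl Hv Hs J.
have [q Hq] := Hv J k l kc lc kl.
have {Hq} : W (v (J + (d k - d l) *+ q)) by exact: Hq.
elim: q J => [|q IH] J; first by rewrite mulr0n addr0.
rewrite mulrS addrA => /IH H.
have := Hs (J + d k); rewrite addrK => H2.
apply: (subgroupDr WG (y := - v (J + d k - d l))) => //.
by apply: subgroupN => //; rewrite -addrA.
Qed.

(* The Vandermonde argument for Dedekind-Mertens: eliminating the last shift
   divides the difference of two relations by [d k - d c]. *)
Lemma shift_vandermonde c (u : nat -> D -> M) :
  (forall i, eventually_in c (u i)) ->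
  (forall k J, (k < c)%N -> W (\sum_(0 <= i < c) u i (J - d k *+ i))) ->
  forall i J, (i < c)%N -> W (u i J).
Proof.
elim: c u => // c IH u Hev Hrel.
(* Synthetic division: with [X_k] for the shift by [d k], [\sum_i u_i (X_k^i - X_c^i) = (X_k - X_c)
   \sum_l v_l X_k^l]. *)
pose v l J := \sum_(l.+1 <= i < c.+1) u i (J - d c *+ (i - l.+1)).
have evw (w : D -> M) : eventually_in c.+1 w -> eventually_in c w.
  by move=> H J k l kc lc; apply: H; exact: ltnW.
have vE l J : (l < c)%N -> v l J = u l.+1 J + v l.+1 (J - d c).
  move=> lc; rewrite /v big_ltn // subnn mulr0n subr0; congr (_ + _).
  apply: eq_big_nat => i /andP[li ic]; congr (u i _).
  by rewrite -addrA -opprD -mulrS; congr (_ - _ *+ _); lia.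
have vW : forall l J, (l < c)%N -> W (v l J).
  apply: IH => [i|k J kc]; first exact/evw/eventually_in_sum.
  have evs : eventually_in c.+1
      (fun J => \sum_(0 <= l < c) v l (J - d k *+ l)).
    apply: (@eventually_in_sum c.+1 _ _ v (fun l => d k *+ l)) => l.
    exact: eventually_in_sum.
  apply: (shift_injective (c := c.+1) (k := k) (l := c) _ _ _ evs) => // [| |{}J]; [lia|lia|].
  have E : \sum_(0 <= l < c) v l (J - d k - d k *+ l) - \sum_(0 <= l < c) v l (J - d c - d k *+ l)
     = \sum_(0 <= i < c.+1) u i (J - d k *+ i) - \sum_(0 <= i < c.+1) u i (J - d c *+ i).
    rewrite [\sum_(0 <= i < c.+1) u i (J - d k *+ i)]big_nat_recl //.
    rewrite [\sum_(0 <= i < c.+1) u i (J - d c *+ i)]big_ltn // !mulr0n !subr0.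
    rewrite opprD addrACA subrr add0r.
    have -> : \sum_(1 <= i < c.+1) u i (J - d c *+ i) = v 0%N (J - d c).
      rewrite /v; apply: eq_big_nat => i /andP[i1 ic]; congr (u i _).
      by rewrite -addrA -opprD -mulrS subn1 prednK.
    have tel : \sum_(0 <= l < c) (v l (J - d c - d k *+ l)
                  - v l.+1 (J - d c - d k *+ l.+1)) = v 0%N (J - d c).
      rewrite sumrB -sumrB.
      under eq_bigr => l _ do rewrite -opprB.
      rewrite sumrN (telescope_sumr (fun l => v l (J - d c - d k *+ l))) //.
      have v0 J' : v c J' = 0 by rewrite /v big_geq.
      by rewrite v0 sub0r opprK mulr0n subr0.
    rewrite -[in RHS]tel -!sumrB; apply: eq_big_nat => l /andP[_ lc].
    rewrite (vE l (J - d k - d k *+ l) lc) (vE l (J - d c - d k *+ l) lc).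
    have -> : J - d k - d k *+ l = J - d k *+ l.+1 by rewrite mulrS opprD addrA.
    have -> : J - d k *+ l.+1 - d c = J - d c - d k *+ l.+1 by rewrite addrAC.
    by rewrite opprB addrA.
  by rewrite E; apply: subgroupB => //; apply: Hrel; lia.
(* The Horner recursion [vE] recovers all [u i.+1] from the [v l]; [u 0] is then left over in the
   relation for [c]. *)
have uS i J : (i < c)%N -> W (u i.+1 J).
  move=> ic; have := vW i J ic; rewrite vE //; apply: subgroupDr => //.
  case: (ltnP i.+1 c) => h; first exact: vW.
  by rewrite /v big_geq //; exact: subgroup0.
move=> [|i] J ic; last exact: uS.
have := Hrel c J (ltnSn c); rewrite big_ltn // mulr0n subr0.
apply: subgroupDr => //; rewrite big_seq; apply: subgroup_sum => // i.
by rewrite mem_index_iota => /andP[i0 i1]; rewrite -(prednK i0); apply: uS; lia.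
Qed.

End Shift.

Section DedekindMertens.
Variables (S : comNzRingType) (T : S -> Prop).
Hypothesis TG : is_subgroup T.

(** [shift_vandermonde] for unit vectors: the [k]-th relation replaces the factor [q (K k)] by a
    convolution with [p]. The relations are homogeneous, so the weight [w] can be fixed;
    [straighten_right] measures its progress by it. *)
Lemma dedekind_mertens_weighted (c : nat) (p : nat -> S) (q : int -> S)
    (w : int) (h : S) :
  (forall z : int, z < 0 -> q z = 0) ->
  (forall (K : {ffun 'I_c -> int}) (k : 'I_c), \sum_l K l = w ->
     T (h * (\prod_(l < c | l != k) q (K l))
          * \sum_(0 <= i < c) p i * q (K k - i%:Z))) ->
  forall (i : nat) (K : {ffun 'I_c -> int}), (i < c)%N ->
    \sum_l K l + i%:Z = w -> T (h * p i * \prod_(l < c) q (K l)).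
Proof.
move=> q0 Hrel i K ic Kw.
pose d k : {ffun 'I_c -> int} := [ffun j : 'I_c => (j == k :> nat)%:Z].
(* The weight test is constant along each relation, since the shift by [d k *+ i] removes from the
   multi-index the [i] that the first factor adds. *)
pose u i (J : {ffun 'I_c -> int}) :=
  if \sum_l J l + i%:Z == w then h * p i * \prod_(l < c) q (J l) else 0.
have dE k t (l : 'I_c) : (d k *+ t) l = if (l == k :> nat) then t%:Z else 0.
  by rewrite ffunMnE ffunE; case: (_ == _); [exact: natz|rewrite mul0rn].
have sumd k t : (k < c)%N -> \sum_l (d k *+ t) l = t%:Z.
  move=> kc; rewrite (bigD1 (Ordinal kc)) //= dE eqxx big1 ?addr0 // => l lk.
  by rewrite dE; case: eqP => // E; case/eqP: lk; apply: val_inj.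
have: T (u i K).
  apply: (shift_vandermonde (c := c) (u := u) (d := d) TG _ _ K ic)
      => [{K Kw ic}i J k l kc lc kl|k J kc].
    exists (`|J (Ordinal lc)|.+1)%N => q' Hq'; rewrite /u; case: ifP => _; last exact: subgroup0 TG.
    rewrite (bigD1 (Ordinal lc)) //= q0 ?mul0r ?mulr0; first exact: subgroup0 TG.
    rewrite ffunE ffunMnE !ffunE /= eqxx eq_sym (negbTE kl).
    have -> : (0 - true%:Z) *+ q' = - q'%:Z by rewrite sub0r mulNrn -[X in _ = - X]natz.
    move: Hq'; rewrite ltrBlDr add0r; move: (J _) => z. lia.
  rewrite /u; have sumJ t : \sum_l (J - d k *+ t) l + t%:Z = \sum_l J l.
    under eq_bigr => l _ do rewrite ffunE [X in _ + X]ffunE.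
    by rewrite sumrB sumd // subrK.
  under eq_bigr => t _ do rewrite sumJ.
  case: (altP (\sum_l J l =P w)) => Jw; last first.
    by rewrite big1 //; exact: subgroup0 TG.
  have := Hrel J (Ordinal kc) Jw; congr T.
  have subE t l : (J - d k *+ t) l = J l - (d k *+ t) l by rewrite !ffunE.
  rewrite mulr_sumr; apply: eq_bigr => t _.
  rewrite [in RHS](bigD1 (Ordinal kc)) //= subE dE /= eqxx.
  under [in RHS]eq_bigr => l lk.
    rewrite subE dE; have -> : (l == k :> nat) = false.
      by apply: contraNF lk => /eqP E; apply/eqP/val_inj.
    rewrite subr0; over.
  by rewrite !mulrA [h * _ * p t]mulrAC [LHS]mulrAC.
by rewrite /u Kw eqxx.
Qed.

(** The full convolutions lie in [T], and they differ from those truncated at [c] by terms with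
    [p]-index at least [c]. So words with small [p]-index reduce to words with large [p]-index. *)
Lemma dedekind_mertens_reduction (c N : nat) (p : nat -> S) (q : int -> S)
    (w : int) (h : S) :
  (c <= N)%N -> (forall z : int, z < 0 -> q z = 0) ->
  (forall s z, T (s * \sum_(0 <= i < N) p i * q (z - i%:Z))) ->
  (forall i (K : {ffun 'I_c -> int}), (c <= i)%N -> (i < N)%N ->
     \sum_l K l + i%:Z = w -> T (h * p i * \prod_(l < c) q (K l))) ->
  forall i (K : {ffun 'I_c -> int}), (i < c)%N ->
     \sum_l K l + i%:Z = w -> T (h * p i * \prod_(l < c) q (K l)).
Proof.
move=> cN q0 HA HB; apply: dedekind_mertens_weighted => // K k Kw.
have -> : \sum_(0 <= i < c) p i * q (K k - i%:Z) =
    \sum_(0 <= i < N) p i * q (K k - i%:Z)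
    - \sum_(c <= i < N) p i * q (K k - i%:Z).
  by rewrite (@big_cat_nat _ _ _ c 0 N) //= addrK.
rewrite mulrBr; apply: subgroupB => //.
rewrite mulr_sumr big_seq; apply: subgroup_sum => // i.
rewrite mem_index_iota => /andP[ci iN].
pose K' := [ffun l => if l == k then K k - i%:Z else K l].
have := HB i K' ci iN; rewrite (bigD1 k) //= ffunE eqxx.
have -> : \sum_(l < c | l != k) K' l = \sum_(l < c | l != k) K l.
  by apply: eq_bigr => l lk; rewrite ffunE (negbTE lk).
rewrite addrAC subrK; move: Kw; rewrite (bigD1 k) //= => Kw /(_ Kw).
rewrite (bigD1 k) //= ffunE eqxx.
have -> : \prod_(l < c | l != k) q (K' l) = \prod_(l < c | l != k) q (K l).
  by apply: eq_bigr => l lk; rewrite ffunE (negbTE lk).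
by congr T; ring.
Qed.

End DedekindMertens.

(** * Contents, their powers, and products of coefficients *)

Section IdealTheory.
Variable A : comNzRingType.
Implicit Types (I J G : set A) (F : {poly A}).

Lemma ideal_subgroup I : is_ideal I -> is_subgroup I.
Proof.
move=> [I0 ID IM]; split=> // x y Ix Iy.
by apply: ID => //; rewrite -mulN1r; exact: IM.
Qed.

Lemma ideal_gen_ideal G : is_ideal (ideal_gen G).
Proof.
split.
- by move=> I [[]].
- by move=> x y Hx Hy I HI; have [[_ ID _] _] := HI; apply: ID; [exact: Hx|exact: Hy].
- by move=> a x Hx I HI; have [[_ _ IM] _] := HI; apply: IM; exact: Hx.
Qed.

Lemma ideal_gen_sub G I : is_ideal I -> (forall x, G x -> I x) ->
  forall x, ideal_gen G x -> I x.
Proof. by move=> HI GI x; apply; split. Qed.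

Lemma mem_ideal_gen G x : G x -> ideal_gen G x.
Proof. by move=> Gx I [_]; apply. Qed.

Lemma content_ideal F : is_ideal (content F).
Proof. exact: ideal_gen_ideal. Qed.

Lemma mem_content F i : content F F`_i.
Proof. by apply: mem_ideal_gen; exists i. Qed.

Lemma content_sub F I : is_ideal I -> (forall i, I F`_i) ->
  forall x, content F x -> I x.
Proof. by move=> HI HF; apply: ideal_gen_sub => // _ [i _ <-]. Qed.

Lemma ideal_sum I (T : Type) (r : seq T) (P : pred T) (E : T -> A) :
  is_ideal I -> (forall i, P i -> I (E i)) -> I (\sum_(i <- r | P i) E i).
Proof. by move=> /ideal_subgroup HI; exact: subgroup_sum. Qed.

Lemma content_mull F1 F2 x : content (F1 * F2) x -> content F1 x.
Proof.
apply: content_sub; first exact: content_ideal.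
move=> i; rewrite coefM; apply: ideal_sum => [|j _]; first exact: content_ideal.
by have [_ _ H] := content_ideal F1; rewrite mulrC; apply: H; exact: mem_content.
Qed.

Lemma ideal_add_ideal I J : is_ideal I -> is_ideal J -> is_ideal (ideal_add I J).
Proof.
move=> [I0 ID IM] [J0 JD JM]; split.
- by exists 0 => //; exists 0; rewrite ?addr0.
- move=> _ _ [x Ix [y Jy <-]] [x' Ix' [y' Jy' <-]]; exists (x + x'); first exact: ID.
  by exists (y + y'); [exact: JD|rewrite addrACA].
- move=> a _ [x Ix [y Jy <-]]; exists (a * x); first exact: IM.
  by exists (a * y); [exact: JM|rewrite mulrDr].
Qed.

Lemma ideal_addl I J x : is_ideal J -> I x -> ideal_add I J x.
Proof. by move=> [J0 _ _] Ix; exists x => //; exists 0; rewrite ?addr0. Qed.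

Lemma ideal_addr I J x : is_ideal I -> J x -> ideal_add I J x.
Proof. by move=> [I0 _ _] Jx; exists 0 => //; exists x; rewrite ?add0r. Qed.

Lemma ideal_exp_ideal I k : is_ideal (ideal_exp I k).
Proof. by case: k => [|k] //; exact: ideal_gen_ideal. Qed.

(** Lists make products concatenations; an index past the degree makes the whole word 0. *)
Definition word F (s : seq nat) : A := \prod_(i <- s) F`_i.

Lemma word_cons F i s : word F (i :: s) = F`_i * word F s.
Proof. by rewrite /word big_cons. Qed.

Lemma word_cat F s1 s2 : word F (s1 ++ s2) = word F s1 * word F s2.
Proof. by rewrite /word big_cat. Qed.

Lemma word_perm F s1 s2 : perm_eq s1 s2 -> word F s1 = word F s2.
Proof. exact: perm_big. Qed.

Lemma word_exp F k s : (k <= size s)%N -> ideal_exp (content F) k (word F s).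
Proof.
elim: k s => // k IH [|i s] //= ks; rewrite word_cons.
apply: mem_ideal_gen; exists F`_i; first exact: mem_content.
by exists (word F s) => //; exact: IH.
Qed.

(** The induction passes through colon ideals of [I], by a coefficient of [F] and then by an element
    of the lower power. *)
Lemma content_exp_sub F k I : is_ideal I ->
  (forall s, size s = k -> I (word F s)) -> forall x, ideal_exp (content F) k x -> I x.
Proof.
elim: k I => [|k IH] I HI HF x.
  move=> _; have [_ _ IM] := HI; rewrite -[x]mulr1; apply: IM.
  by have := HF [::] erefl; rewrite /word big_nil.
have [I0 ID IM] := HI.
apply: ideal_gen_sub => // _ [y Cy [z Ez <-]].
have {Ez} Ez i : I (F`_i * z).
  apply: (IH (fun z => I (F`_i * z))) Ez; first split=> [|u v|u v].
  - by rewrite mulr0.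
  - by rewrite mulrDr; exact: ID.
  - by rewrite mulrCA; exact: IM.
  by move=> s sk; rewrite -word_cons; apply: HF; rewrite /= sk.
apply: (content_sub (I := fun y => I (y * z)) _ Ez) Cy; split=> [|u v|u v].
- by rewrite mul0r.
- by rewrite mulrDl; exact: ID.
- by rewrite -mulrA; exact: IM.
Qed.

(** Integer indices let multi-indices be shifted without truncated subtraction. *)
Definition coefz F (z : int) : A := if z is Posz k then F`_k else 0.

Lemma coefz_lt0 F (z : int) : z < 0 -> coefz F z = 0.
Proof. by case: z. Qed.

Lemma coefz_Posz F (k : nat) : coefz F k = F`_k.
Proof. by []. Qed.

Lemma coefz_ge F (z : int) : (size F)%:Z <= z -> coefz F z = 0.
Proof. by case: z => // k h; rewrite coefz_Posz nth_default //; lia. Qed.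

Lemma coefzM F1 F2 N (z : int) : (size F1 <= N)%N ->
  \sum_(0 <= i < N) F1`_i * coefz F2 (z - i%:Z) = coefz (F1 * F2) z.
Proof.
move=> sN; case: z => k; last first.
  by rewrite big1 // => i _; rewrite (@coefz_lt0 F2) ?mulr0 //; lia.
rewrite coefz_Posz coefM -(big_mkord predT (fun i => F1`_i * F2`_(k - i))) /=.
have -> : \sum_(0 <= i < N) F1`_i * coefz F2 (k%:Z - i%:Z) =
          \sum_(0 <= i < maxn N k.+1) F1`_i * coefz F2 (k%:Z - i%:Z).
  rewrite [RHS](@big_cat_nat _ _ _ N) ?leq_maxl //= [X in _ + X]big_nat_cond.
  rewrite [X in _ + X]big1 ?addr0 // => i /andP[/andP[Ni _] _].
  by rewrite nth_default ?mul0r //; exact: leq_trans sN Ni.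
rewrite (@big_cat_nat _ _ _ k.+1) ?leq_maxr //= [X in _ + X]big_nat_cond.
rewrite [X in _ + X]big1 ?addr0 => [|i /andP[/andP[ki _] _]].
  apply: eq_big_nat => i /andP[_ ik]; congr (_ * _).
  by rewrite -coefz_Posz; congr coefz; lia.
by rewrite (@coefz_lt0 F2) ?mulr0 //; lia.
Qed.

Lemma prod_coefz F c (K : 'I_c -> int) :
  (exists2 s, size s = c /\ (sumn s)%:Z = \sum_l K l
     & \prod_(l < c) coefz F (K l) = word F s)
  \/ \prod_(l < c) coefz F (K l) = 0.
Proof.
elim: c K => [|c IH] K.
  by left; exists [::]; rewrite ?big_ord0 /word ?big_nil.
rewrite !big_ord_recl; case: (K ord0) => [k|k]; last by right; rewrite mul0r.
case: (IH (fun l => K (lift ord0 l))) => [[s [ss sumE] ->]|->]; last by right; rewrite mulr0.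
left; exists (k :: s); last by rewrite word_cons.
by rewrite /= ss -sumE PoszD.
Qed.

End IdealTheory.

(** * Dedekind-Mertens inclusion and straightening of words *)

Section Straightening.
Variables (S : comNzRingType) (p q : {poly S}).

Lemma word_coefz F (s : seq nat) c : size s = c ->
  word F s = \prod_(l < c) coefz F (nth 0%N s l)%:Z :> S.
Proof. by move=> <-; rewrite /word (big_nth 0%N) big_mkord. Qed.

Lemma sumn_nth (s : seq nat) c : size s = c -> \sum_(l < c) (nth 0%N s l)%:Z = (sumn s)%:Z.
Proof.
by move=> <-; rewrite sumnE (big_nth 0%N) big_mkord (raddf_sum Posz).
Qed.

(** The case [N = c] of the reduction: as [c] is at least [size p], no coefficient of [p] with index
    [c] or more remains to reduce to. *)
Lemma dedekind_mertens c i s : (size p <= c)%N -> size s = c ->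
  content (p * q) (p`_i * word q s).
Proof.
move=> pc sc; have CI := content_ideal (p * q); have [C0 _ CM] := CI.
case: (ltnP i c) => ic; last by rewrite nth_default ?mul0r //; exact: leq_trans pc ic.
rewrite (word_coefz _ sc) -[p`_i]mul1r.
pose K : {ffun 'I_c -> int} := [ffun l : 'I_c => (nth 0%N s l)%:Z].
have -> : \prod_(l < c) coefz q (nth 0%N s l)%:Z = \prod_(l < c) coefz q (K l).
  by apply: eq_bigr => l _; rewrite ffunE.
apply: (@dedekind_mertens_reduction _ _ (ideal_subgroup CI) c c
  (fun i => p`_i) (coefz q) (\sum_l K l + i%:Z)) => //.
- exact: coefz_lt0.
- move=> t z; apply: CM; rewrite coefzM //.
  by case: z => k //; exact: mem_content.
- lia.
Qed.
End Straightening.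

Section Spanning.
Variables (S : comNzRingType) (p q : {poly S}) (m n a b : nat).
Variable T : S -> Prop.
Hypotheses (sp : (size p <= m.+1)%N) (sq : (size q <= n.+1)%N).
Hypotheses (an : (a <= n)%N) (bm : (b <= m)%N).
Hypotheses (TG : is_subgroup T) (Tpq : forall x, content (p * q) x -> T x).

Let Tmul s z : T (s * coefz (p * q) z).
Proof.
apply: Tpq; have [C0 _ CM] := content_ideal (p * q); apply: CM.
by case: z => k //; exact: mem_content.
Qed.

(** The [b] factors of [q] provide [b] independent shifts, so a [p]-index below [b] can be traded
    for indices at least [b]; this raises [sumn I]. *)
Lemma straighten_left I J i : size I = a -> size J = b -> i \in I -> (i < b)%N ->
  (forall I' J', size I' = a -> size J' = b -> (sumn I < sumn I')%N ->
     T (word p I' * word q J')) -> T (word p I * word q J).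
Proof.
move=> sI sJ iI ib IH.
have pI := perm_to_rem iI; have sI0 : (size (rem i I)).+1 = a by rewrite -sI (perm_size pI).
rewrite (word_perm _ pI) word_cons [p`_i * _]mulrC (word_coefz _ sJ).
pose K : {ffun 'I_b -> int} := [ffun l : 'I_b => (nth 0%N J l)%:Z].
have -> : \prod_(l < b) coefz q (nth 0%N J l)%:Z = \prod_(l < b) coefz q (K l).
  by apply: eq_bigr => l _; rewrite ffunE.
apply: (@dedekind_mertens_reduction _ _ TG b m.+1
  (fun i => p`_i) (coefz q) (\sum_l K l + i%:Z)) => //.
- lia.
- exact: coefz_lt0.
- by move=> t z; rewrite coefzM.
move=> i' K' bi' _ _; case: (prod_coefz q K') => [[J' [sJ' _] ->]|->]; last first.
  by rewrite mulr0; exact: (subgroup0 TG).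
rewrite [_ * p`_i']mulrC -word_cons; apply: IH => //=.
by rewrite (perm_sumn pI) /=; lia.
Qed.

(** The mirror image of [straighten_left]: roles of [p] and [q] exchanged and indices reversed, [j]
    to [n - j] and [i] to [m - i]. The [a] factors of [p] eliminate reversed indices below [a], that
    is [j > n - a]. The other [q]-index drops, and since the weight is fixed the [p]-indices must
    rise. *)
Lemma straighten_right I J j : size I = a -> size J = b -> j \in J -> (n - a < j)%N ->
  (j <= n)%N -> {in I, forall i, i <= m}%N ->
  (forall I' J', size I' = a -> size J' = b -> (sumn I < sumn I')%N ->
     T (word p I' * word q J')) -> T (word p I * word q J).
Proof.
move=> sI sJ jJ nj jn Im IH.
have pJ := perm_to_rem jJ; have sJ0 : (size (rem j J)).+1 = b by rewrite -sJ (perm_size pJ).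
rewrite (word_perm _ pJ) word_cons mulrC (mulrC q`_j) (word_coefz _ sI).
pose K : {ffun 'I_a -> int} := [ffun l : 'I_a => m%:Z - (nth 0%N I l)%:Z].
have -> : \prod_(l < a) coefz p (nth 0%N I l)%:Z = \prod_(l < a) coefz p (m%:Z - K l).
  by apply: eq_bigr => l _; rewrite ffunE opprB addrC subrK.
have -> : q`_j = coefz q (n%:Z - (n - j)%N%:Z).
  by rewrite -coefz_Posz; congr coefz; lia.
have sumK (K' : {ffun 'I_a -> int}) : \sum_l (m%:Z - K' l) = (a * m)%N%:Z - \sum_l K' l.
  by rewrite sumrB sumr_const card_ord -mulr_natl PoszM natz.
have sumI : \sum_l (m%:Z - K l) = (sumn I)%:Z.
  rewrite -(sumn_nth sI); apply: eq_bigr => l _.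
  by rewrite ffunE opprB addrC subrK.
apply: (@dedekind_mertens_reduction _ _ TG a n.+1
  (fun l => coefz q (n%:Z - l%:Z)) (fun z => coefz p (m%:Z - z)) (\sum_l K l + (n - j)%N%:Z)) => //.
- lia.
- by move=> z z0; rewrite coefz_ge //; lia.
- move=> t z.
  have -> : \sum_(0 <= i < n.+1) coefz q (n%:Z - i%:Z) * coefz p (m%:Z - (z - i%:Z))
     = coefz (p * q) (n%:Z + m%:Z - z); last exact: Tmul.
  rewrite mulrC -(coefzM _ _ sq) big_nat_rev /=; apply: eq_big_nat => i /andP[_ ilt].
  rewrite add0n subSS -coefz_Posz; congr (coefz q _ * coefz p _); lia.
- move=> l K' al ln sumK'.
  case: (prod_coefz p (fun t => m%:Z - K' t)) => [[I' [sI' sumI'] ->]|->]; last first.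
    by rewrite mulr0; exact: (subgroup0 TG).
  have -> : n%:Z - l%:Z = (n - l)%N by lia.
  rewrite coefz_Posz [_ * q`_ _]mulrC -word_cons mulrC; apply: IH => //=.
  by move: sumI sumI'; rewrite !sumK; lia.
- lia.
Qed.

Hypothesis Tstd : forall I J, size I = a -> size J = b ->
  all (fun i => b <= i <= m)%N I -> all (fun j => j <= n - a)%N J ->
  T (word p I * word q J).

(* Both rewriting rules strictly increase [sumn I], which is at most [a * m]. *)
Lemma straightening I J : size I = a -> size J = b -> T (word p I * word q J).
Proof.
have word0 (F : {poly S}) (N : nat) (s : seq nat) i :
    (size F <= N)%N -> i \in s -> (N <= i)%N -> word F s = 0.
  move=> sF /perm_to_rem /(word_perm F) -> Ni.
  by rewrite word_cons nth_default ?mul0r //; exact: leq_trans sF Ni.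
have [k] := ubnP (a * m - sumn I)%N.
elim: k I J => // k IH I J kI sI sJ.
case: (altP (@allP _ (fun i => i <= m)%N I)) => [Im|/allPn[i iI im]]; last first.
  by rewrite (word0 _ _ _ _ sp iI) ?mul0r; [exact: (subgroup0 TG)|lia].
case: (altP (@allP _ (fun i => i <= n)%N J)) => [Jn|/allPn[i iJ inn]]; last first.
  by rewrite (word0 _ _ _ _ sq iJ) ?mulr0; [exact: (subgroup0 TG)|lia].
have sumle I' : {in I', forall i, i <= m}%N -> (sumn I' <= size I' * m)%N.
  elim: I' => //= i I' IHI H; rewrite mulSn leq_add ?H ?mem_head //.
  by apply: IHI => j jI; apply: H; rewrite inE jI orbT.
have IH' I' J' : size I' = a -> size J' = b -> (sumn I < sumn I')%N -> T (word p I' * word q J').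
  move=> sI' sJ' lt.
  case: (altP (@allP _ (fun i => i <= m)%N I')) => [Im'|/allPn[i iI im]]; last first.
    by rewrite (word0 _ _ _ _ sp iI) ?mul0r; [exact: (subgroup0 TG)|lia].
  by apply: IH => //; have := sumle I' Im'; rewrite sI'; lia.
case: (altP (@allP _ (leq b) I)) => [Ib|/allPn[i iI ib]]; last first.
  by apply: (straighten_left sI sJ iI) => //; lia.
case: (altP (@allP _ (fun j => j <= n - a)%N J)) => [Ja|/allPn[j jJ jn]]; last first.
  by apply: (straighten_right sI sJ jJ) => //; [lia|exact: Jn].
by apply: Tstd => //; apply/allP => i iI; [rewrite Ib ?Im|exact: Ja].
Qed.

End Spanning.

(** * The resultant form *)

Section BinaryMatrices.
Variables (R : comNzRingType) (n m : nat).
Implicit Types (E : {ffun 'I_n * 'I_m -> bool}).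

Definition row_ones E (i : 'I_n) : nat := (\sum_(j < m) E (i, j))%N.
Definition col_zeros E (j : 'I_m) : nat := (\sum_(i < n) ~~ E (i, j))%N.

Definition has_margins (r : 'I_n -> nat) (z : 'I_m -> nat) E : bool :=
  [forall i, row_ones E i == r i] && [forall j, col_zeros E j == z j].

Definition msign E : R := (-1) ^+ (\sum_(j < m) col_zeros E j)%N.

(* The coefficient of [\prod_i t_i ^+ r i * \prod_j s_j ^+ z j] in
   [\prod_i \prod_j (t_i - s_j)]: [E] selects [t_i] or [- s_j] in each factor. *)
Definition margin_count (r : 'I_n -> nat) (z : 'I_m -> nat) : R :=
  \sum_(E : {ffun 'I_n * 'I_m -> bool} | has_margins r z E) msign E.

Lemma eq_margin_count r r' z z' : r =1 r' -> z =1 z' ->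
  margin_count r z = margin_count r' z'.
Proof.
move=> rr zz; apply: eq_bigl => E; congr (_ && _); apply: eq_forallb => i.
  by rewrite rr.
by rewrite zz.
Qed.

Lemma row_ones_le E i : (row_ones E i <= m)%N.
Proof.
rewrite -[X in (_ <= X)%N]card_ord -sum1_card; apply: leq_sum => j _; exact: leq_b1.
Qed.

Lemma col_zeros_le E j : (col_zeros E j <= n)%N.
Proof.
rewrite -[X in (_ <= X)%N]card_ord -sum1_card; apply: leq_sum => i _; exact: leq_b1.
Qed.

Lemma margin_count_perm r z (s : 'S_n) (t : 'S_m) :
  margin_count (r \o s) (z \o t) = margin_count r z.
Proof.
pose h (s : 'S_n) (t : 'S_m) E : {ffun 'I_n * 'I_m -> bool} := [ffun p => E (s p.1, t p.2)].
have hK s' t' : cancel (h s' t') (h s'^-1%g t'^-1%g).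
  by move=> E; apply/ffunP => -[i j]; rewrite !ffunE /= !permKV.
have hr s' t' E i : row_ones (h s' t' E) i = row_ones E (s' i).
  rewrite /row_ones [RHS](reindex_inj (@perm_inj _ t')) /=.
  by apply: eq_bigr => j _; rewrite ffunE.
have hz s' t' E j : col_zeros (h s' t' E) j = col_zeros E (t' j).
  rewrite /col_zeros [RHS](reindex_inj (@perm_inj _ s')) /=.
  by apply: eq_bigr => i _; rewrite ffunE.
rewrite /margin_count (reindex_inj (can_inj (hK s t))) /=; apply: eq_big => E.
  congr (_ && _); apply/forallP/forallP => H i.
  - by have := H (s^-1%g i); rewrite hr /= permKV.
  - by rewrite hr; exact: H.
  - by have := H (t^-1%g i); rewrite hz /= permKV.
  - by rewrite hz; exact: H.
move=> _; congr (_ ^+ _); rewrite [RHS](reindex_inj (@perm_inj _ t)).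
by apply: eq_bigr => j _; rewrite hz.
Qed.

(** The product of the [t_i - s_j] is symmetric in the [t_i] and in the [s_j]; this lets [res_form]
    be computed from any ordering of a monomial. *)
Lemma margin_count_perm_eq I I' J J' : size I = n -> size J = m ->
  perm_eq I I' -> perm_eq J J' ->
  margin_count (fun i => nth 0%N I i) (fun j => nth 0%N J j) =
  margin_count (fun i => nth 0%N I' i) (fun j => nth 0%N J' j).
Proof.
move=> sI sJ pI pJ.
have sI' : size I' == n by rewrite -(perm_size pI) sI.
have sJ' : size J' == m by rewrite -(perm_size pJ) sJ.
have /tuple_permP[s Is] : perm_eq I (Tuple sI') by [].
have /tuple_permP[t Jt] : perm_eq J (Tuple sJ') by [].
rewrite -[RHS](margin_count_perm _ _ s t); apply: eq_margin_count => i /=.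
  by rewrite Is (nth_map i) ?size_enum_ord // nth_ord_enum (tnth_nth 0%N).
by rewrite Jt (nth_map i) ?size_enum_ord // nth_ord_enum (tnth_nth 0%N).
Qed.

End BinaryMatrices.

Section Involution.
Variables (R : comNzRingType) (n m : nat).
Implicit Types (E : {ffun 'I_n.+1 * 'I_m.+1 -> bool}).

Let flip E : {ffun 'I_n.+1 * 'I_m.+1 -> bool} :=
  [ffun p => if p == (ord0, ord0) then ~~ E p else E p].

(* Toggling the entry (0, 0) preserves [row_ones E 0 + col_zeros E 0] and changes
   the sign; on polynomials, [t_0 - s_0] vanishes when [t_0 = s_0]. *)
Lemma margin_count_conv (I J : seq nat) k :
  \sum_(i < k.+1) margin_count R (fun l : 'I_n.+1 => nth 0%N (nat_of_ord i :: I) l)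
     (fun l : 'I_m.+1 => nth 0%N ((k - i)%N :: J) l) = 0.
Proof.
pose rest E := [forall i : 'I_n, row_ones E (lift ord0 i) == nth 0%N I i] &&
  [forall j : 'I_m, col_zeros E (lift ord0 j) == nth 0%N J j].
pose tot E := (row_ones E ord0 + col_zeros E ord0)%N.
have forallS c (P : 'I_c.+1 -> bool) :
    [forall i, P i] = P ord0 && [forall i : 'I_c, P (lift ord0 i)].
  apply/forallP/andP => [H|[H0 /forallP H] i]; first by split=> //; apply/forallP.
  by case: (unliftP ord0 i) => [j|] ->.
have -> : \sum_(i < k.+1) margin_count R (fun l : 'I_n.+1 => nth 0%N (nat_of_ord i :: I) l)
     (fun l : 'I_m.+1 => nth 0%N ((k - i)%N :: J) l)
  = \sum_(E | rest E && (tot E == k)) msign R E.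
  rewrite /margin_count; under eq_bigr => i _ do rewrite big_mkcond.
  rewrite exchange_big [RHS]big_mkcond /=; apply: eq_bigr => E _.
  rewrite /has_margins; under eq_bigr => i _ do rewrite !forallS /= andbACA -/(rest E) andbC.
  case: (rest E) => /=; last by rewrite big1.
  rewrite -big_mkcond /=; case: (altP (tot E =P k)) => [Ek|Ek].
    have rk : (row_ones E ord0 < k.+1)%N by rewrite -Ek ltnS leq_addr.
    rewrite (big_pred1 (Ordinal rk)) // => i /=; rewrite -val_eqE /= [RHS]eq_sym.
    by case: eqP => //= E0; apply/eqP; move: Ek; rewrite /tot; lia.
  rewrite big_pred0 // => i; apply/negbTE; apply: contra Ek => /andP[/eqP E1 /eqP E2].
  by rewrite /tot E1 E2 subnKC // -ltnS.
have flipK : involutive flip.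
  by move=> E; apply/ffunP => p; rewrite !ffunE; case: eqP => // _; rewrite negbK.
have fr E i : row_ones (flip E) (lift ord0 i) = row_ones E (lift ord0 i).
  by apply: eq_bigr => j _; rewrite ffunE.
have fz E j : col_zeros (flip E) (lift ord0 j) = col_zeros E (lift ord0 j).
  by apply: eq_bigr => i _; rewrite ffunE xpair_eqE andbF.
have fr0 E : E (ord0, ord0) -> row_ones E ord0 = (row_ones (flip E) ord0).+1.
  move=> E0; rewrite /row_ones !big_ord_recl ffunE eqxx E0 /= add1n add0n; congr _.+1.
  by apply: eq_bigr => j _; rewrite ffunE.
have fz0 E : E (ord0, ord0) -> col_zeros (flip E) ord0 = (col_zeros E ord0).+1.
  move=> E0; rewrite /col_zeros !big_ord_recl ffunE eqxx E0 /= add1n add0n; congr _.+1.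
  by apply: eq_bigr => j _; rewrite ffunE.
have frest E : rest (flip E) = rest E.
  by congr (_ && _); apply: eq_forallb => i; rewrite ?fr ?fz.
have fsign E : E (ord0, ord0) -> msign R (flip E) = - msign R E.
  move=> E0; rewrite /msign !big_ord_recl fz0 // addSn exprS mulN1r.
  by congr (- (_ ^+ (_ + _))); apply: eq_bigr => j _; rewrite fz.
rewrite (bigID (fun E => E (ord0, ord0))) /= [X in _ + X](reindex_inj (inv_inj flipK)) /=.
rewrite [X in _ + X](eq_big (fun E => rest E && (tot E == k) && E (ord0, ord0))
  (fun E => - msign R E)); first by rewrite sumrN subrr.
- move=> E; rewrite frest ffunE eqxx negbK.
  case E0: (E _); rewrite ?andbF //; congr (_ && (_ == _) && _).
  by rewrite /tot (fz0 E) // (fr0 E) // addSnnS.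
- by move=> E; rewrite ffunE eqxx negbK => /andP[_]; exact: fsign.
Qed.

End Involution.

Lemma sum_ltn_ord c r : (\sum_(l < c) (l < r) = minn r c)%N.
Proof.
elim: c => [|c IH]; first by rewrite big_ord0; lia.
by rewrite big_ord_recr /= IH; lia.
Qed.

Lemma sum_negb_ord c (P : 'I_c -> bool) : (\sum_(l < c) P l + \sum_(l < c) ~~ P l = c)%N.
Proof.
rewrite -big_split /= -[RHS]card_ord -sum1_card; apply: eq_bigr => l _.
by case: (P l).
Qed.

Lemma initial_segmentE c (P : 'I_c -> bool) :
  (forall l l' : 'I_c, (l' <= l)%N -> P l -> P l') ->
  forall l, P l = (l < \sum_(l' < c) P l')%N.
Proof.
move=> HP l; apply/idP/idP => [Pl|].
  have -> : l.+1 = (\sum_(l' < c) (l' < l.+1))%N.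
    by rewrite sum_ltn_ord; apply/esym/minn_idPl.
  by apply: leq_sum => l' _; case: ltnP => // h; rewrite (HP l).
apply: contraLR => nPl; rewrite -leqNgt.
have <- : (\sum_(l' < c) (l' < l) = l)%N.
  by rewrite sum_ltn_ord; apply/minn_idPl/ltnW.
apply: leq_sum => l' _; case: (ltnP l' l) => h; first exact: leq_b1.
by case Pl': (P l') => //; rewrite (HP l' l) in nPl.
Qed.

(** * Young diagrams and triangularity of the pairing *)

Section Shapes.
Variables (R : comNzRingType) (n m a b : nat).
Implicit Types (E L G : {ffun 'I_n * 'I_m -> bool}).

(* Young diagrams in the n x m rectangle whose boundary passes through (a, b). *)
Definition corner_shape L : Prop :=
  [/\ forall (i i' : 'I_n) (j j' : 'I_m), (i' <= i)%N -> (j' <= j)%N -> L (i, j) -> L (i', j'),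
      forall (i : 'I_n) (j : 'I_m), (i < a)%N -> (j < b)%N -> L (i, j)
    & forall (i : 'I_n) (j : 'I_m), (a <= i)%N -> (b <= j)%N -> ~~ L (i, j)].

(** The order for triangularity. The signs are such that [shape_key L - shape_key G] is the excess
    in [mixed_margins]: the sum of the column indices of the ones of [E], minus that of the
    left-justified matrix with the same row sums. *)
Definition shape_key L : int :=
  \sum_(j < m) (if (j < b)%N then - (j : nat)%:Z else (j : nat)%:Z) * (col_zeros L j)%:Z.

Lemma shape_row L i j : corner_shape L -> L (i, j) = (j < row_ones L i)%N.
Proof.
move=> [H _ _]; apply: (@initial_segmentE _ (fun j => L (i, j))) => l l' ll'.
exact: H.
Qed.

Lemma shape_col L i j : corner_shape L -> L (i, j) = (i < n - col_zeros L j)%N.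
Proof.
move=> [H _ _]; rewrite -[in X in (X - _)%N](sum_negb_ord (fun i => L (i, j))) addnK.
apply: (@initial_segmentE _ (fun i => L (i, j))) => l l' ll'.
exact: H.
Qed.

(** With [mixed_cols], the exponents in the product of the head monomial of [L] and the tail
    monomial of [G]. *)
Definition mixed_rows L G (i : 'I_n) := if (i < a)%N then row_ones L i else row_ones G i.
Definition mixed_cols L G (j : 'I_m) := if (j < b)%N then col_zeros L j else col_zeros G j.

(* Among binary matrices with prescribed row sums, the left-justified one is
   the unique minimizer of the sum of the column indices of the ones. *)
Lemma mixed_margins L G E : corner_shape L -> corner_shape G ->
  has_margins (mixed_rows L G) (mixed_cols L G) E ->
  shape_key G <= shape_key L /\ (shape_key G = shape_key L -> G = L /\ E = L).
Proof.
move=> sL sG /andP[/forallP Er /forallP Ez].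
pose r := mixed_rows L G.
(* The left-justified matrix with the prescribed row sums: the rows of [L] above level [a], those of
   [G] below. *)
pose Th : {ffun 'I_n * 'I_m -> bool} :=
  [ffun p : 'I_n * 'I_m => if (p.1 < a)%N then L p else G p].
have ThE i j : Th (i, j) = (j < r i)%N.
  by rewrite ffunE /r /mixed_rows /=; case: ifP => _; exact: shape_row.
have Thr i : row_ones Th i = r i.
  rewrite /row_ones; under eq_bigr => j _ do rewrite ThE.
  rewrite sum_ltn_ord; apply/minn_idPl; rewrite /r /mixed_rows.
  by case: ifP => _; exact: row_ones_le.
(* Both diagrams contain the [a] x [b] corner and avoid the opposite one, so the column margins of
   [Th] are those of [mixed_cols] with [L] and [G] exchanged. *)
have Thz j : col_zeros Th j = if (j < b)%N then col_zeros G j else col_zeros L j.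
  have [_ L1 L2] := sL; have [_ G1 G2] := sG.
  case: ltnP => jb; apply: eq_bigr => i _; rewrite ffunE /=; case: ltnP => ia //.
    by rewrite L1 ?G1.
  by rewrite (negbTE (L2 _ _ _ _)) ?(negbTE (G2 _ _ _ _)).
have zero_one E' j : \sum_(i < n) (E' (i, j) : nat)%:Z = n%:Z - (col_zeros E' j)%:Z.
  have := sum_negb_ord (fun i => E' (i, j)).
  rewrite -(raddf_sum Posz) /= -/(col_zeros E' j); set x := bigop _ _ _; lia.
(* The factor [2 j + 1 - 2 r i] is odd, hence nonzero, and negative exactly on the ones of [Th]. So
   each term is nonnegative, and it is 0 only where [E] and [Th] agree. *)
pose t (i : 'I_n) (j : 'I_m) : int :=
  ((j : nat).*2.+1%:Z - (r i).*2%:Z) * ((E (i, j) : nat)%:Z - (Th (i, j) : nat)%:Z).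
have t_ge0 i j : 0 <= t i j.
  rewrite /t ThE; case: ltnP => h; case: (E _) => /=;
    rewrite ?subrr ?mulr0 ?sub0r ?subr0 ?mulrN1 ?mulr1 //; lia.
have tE : \sum_i \sum_j t i j = (shape_key L - shape_key G) *+ 2.
  rewrite /t; under eq_bigr => i _ do under eq_bigr => j _ do rewrite mulrBl.
  under eq_bigr => i _ do rewrite sumrB -[X in _ - X]mulr_sumr sumrB.
  have rowE i : \sum_j (E (i, j) : nat)%:Z - \sum_j (Th (i, j) : nat)%:Z = 0.
    rewrite -!(raddf_sum Posz) /= -/(row_ones E i) -/(row_ones Th i) Thr.
    by rewrite (eqP (Er i)) subrr.
  under eq_bigr => i _ do rewrite rowE mulr0 subr0.
  rewrite exchange_big /=; under eq_bigr => j _ do rewrite -mulr_sumr sumrB !zero_one.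
  (* Equal row sums give equal numbers of zeros; this absorbs the summand 1 of the odd weight. *)
  have S0 : \sum_(j < m) (n%:Z - (col_zeros E j)%:Z - (n%:Z - (col_zeros Th j)%:Z)) = 0.
    under eq_bigr => j _ do rewrite -!zero_one.
    by rewrite sumrB exchange_big [X in _ - X]exchange_big -sumrB big1.
  rewrite /shape_key -sumrB -sumrMnl -[RHS]addr0 -[X in _ = _ + X]S0 -big_split /=.
  apply: eq_bigr => j _.
  rewrite Thz (eqP (Ez j)) /mixed_cols; case: ifP => _; lia.
split.
  have : 0 <= \sum_i \sum_j t i j by do 2!apply: sumr_ge0 => ? _.
  by rewrite tE; lia.
move=> eqk; have Sum0 : \sum_i \sum_j t i j = 0 by rewrite tE eqk subrr mul0rn.
have EE : E = Th.
  apply/ffunP => -[i j].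
  have t0 : t i j = 0.
    have := @psumr_eq0P _ _ xpredT (fun i => \sum_j t i j).
    move=> /(_ (fun i _ => sumr_ge0 _ (fun j _ => t_ge0 i j)) Sum0 i isT).
    by move=> /psumr_eq0P -> //.
  move: t0; rewrite /t => /eqP; rewrite mulf_eq0 => /orP[|]; first by lia.
  by case: (E _); case: (Th _).
have zz j : col_zeros L j = col_zeros G j.
  have := eqP (Ez j); rewrite EE Thz /mixed_cols.
  by case: ifP => _ ->.
have GL : G = L.
  by apply/ffunP => -[i j]; rewrite (shape_col _ _ sL) (shape_col _ _ sG) zz.
by split=> //; rewrite EE; apply/ffunP => p; rewrite ffunE GL if_same.
Qed.

Lemma mixed_margin_count0 L G : corner_shape L -> corner_shape G -> shape_key L <= shape_key G ->
  L != G -> margin_count R (mixed_rows L G) (mixed_cols L G) = 0.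
Proof.
move=> sL sG le LG; apply: big_pred0 => E; apply/negbTE; apply/negP => /(mixed_margins sL sG).
move=> [le' H]; have [|GL _] := H; first by apply/eqP; rewrite eq_le le'.
by rewrite GL eqxx in LG.
Qed.

Lemma mixed_margin_countE L : corner_shape L ->
  margin_count R (mixed_rows L L) (mixed_cols L L) = msign R L.
Proof.
move=> sL; rewrite /margin_count (big_pred1 L) // => E /=; apply/idP/eqP => [|->].
  by move=> /(mixed_margins sL sL)[_ /(_ erefl)[_]].
by apply/andP; split; apply/forallP => i; rewrite /mixed_rows /mixed_cols if_same.
Qed.

(** Sorted decreasingly, [I] gives the lengths of the top [a] rows; sorted increasingly, [J] gives
    the numbers of zeros in the left [b] columns, which fix the remaining rows. The bounds on [I]
    and [J] make the two pieces fit at the corner [(a, b)]. *)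
Lemma shape_exists (I J : seq nat) : (a <= n)%N -> (b <= m)%N ->
  size I = a -> size J = b -> all (fun i => b <= i <= m)%N I -> all (fun j => j <= n - a)%N J ->
  exists L I' J', [/\ corner_shape L, perm_eq I I', perm_eq J J',
    forall i : 'I_n, (i < a)%N -> row_ones L i = nth 0%N I' i
  & forall j : 'I_m, (j < b)%N -> col_zeros L j = nth 0%N J' j].
Proof.
move=> an bm sI sJ bI bJ.
pose I1 := sort geq I; pose J1 := sort leq J.
have pI : perm_eq I I1 by rewrite perm_sym perm_sort.
have pJ : perm_eq J J1 by rewrite perm_sym perm_sort.
have sI1 : size I1 = a by rewrite size_sort.
have sJ1 : size J1 = b by rewrite size_sort.
have {}bI i : (i < a)%N -> (b <= nth 0 I1 i <= m)%N.
  move=> ia; apply: (allP bI); rewrite (perm_mem pI); by apply: mem_nth; rewrite ?sI1 ?sJ1.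
have {}bJ j : (j < b)%N -> (nth 0 J1 j <= n - a)%N.
  move=> jb; apply: (allP bJ); rewrite (perm_mem pJ); by apply: mem_nth; rewrite ?sI1 ?sJ1.
have decI i i' : (i' <= i)%N -> (i < a)%N -> (nth 0 I1 i <= nth 0 I1 i')%N.
  move=> ii ia; apply: (sorted_leq_nth (leT := geq)); rewrite ?inE ?sI1 //;
    [|exact: leqnn|apply: sort_sorted|lia].
    by move=> ? ? ? /= h1 h2; exact: leq_trans h2 h1.
  by move=> x y; exact: leq_total.
have incJ j j' : (j' <= j)%N -> (j < b)%N -> (nth 0 J1 j' <= nth 0 J1 j)%N.
  move=> ii ia; apply: (sorted_leq_nth (leT := leq)); rewrite ?inE ?sJ1 //;
    [exact: leq_trans|apply: sort_sorted|lia].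
  exact: leq_total.
pose L : {ffun 'I_n * 'I_m -> bool} := [ffun p : 'I_n * 'I_m =>
  if (p.1 < a)%N then (p.2 < nth 0 I1 p.1)%N else (p.2 < b)%N && (p.1 < n - nth 0 J1 p.2)%N].
have Lr (i : 'I_n) : (i < a)%N -> row_ones L i = nth 0%N I1 i.
  move=> ia; rewrite /row_ones; under eq_bigr => j _ do rewrite ffunE /= ia.
  by rewrite sum_ltn_ord; apply/minn_idPl; have /andP[] := bI i ia.
have Lz (j : 'I_m) : (j < b)%N -> col_zeros L j = nth 0%N J1 j.
  move=> jb; have := sum_negb_ord (fun i => L (i, j)); rewrite -/(col_zeros L j).
  have -> : (\sum_(i < n) L (i, j) = n - nth 0 J1 j)%N.
    rewrite -[RHS](minn_idPl (leq_subr _ _) : minn _ n = _) -sum_ltn_ord.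
    apply: eq_bigr => i _; rewrite ffunE /= jb; case: ltnP => //= ia.
    have := bI i ia; have := bJ j jb; lia.
  have := bJ j jb; lia.
exists L, I1, J1; split=> //.
split=> [i i' j j' ii jj|i j ia jb|i j ai bj]; rewrite !ffunE /=.
- case: (ltnP i a) => ia.
    rewrite (leq_ltn_trans ii ia) => h; apply: leq_ltn_trans jj _.
    exact: leq_trans h (decI _ _ ii ia).
  move=> /andP[jb h]; case: (ltnP i' a) => ia'.
    have := bI _ ia'; lia.
  rewrite (leq_ltn_trans jj jb) /=.
  have := incJ _ _ jj jb; lia.
- by rewrite ia; have := bI i ia; lia.
- by rewrite ltnNge ai /= ltnNge bj.
Qed.

End Shapes.

(** * The resultant form on S and its annihilator *)

Section Functional.
Variables (R : comNzRingType) (m n : nat).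
Local Notation N := (m.+1 + n.+1)%N.
Local Notation S := {mpoly R[N]}.
Local Notation f := (generic_f R m n : {poly S}).
Local Notation g := (generic_g R m n : {poly S}).

Lemma coef_generic_f (i : 'I_m.+1) : f`_i = 'X_(lshift n.+1 i).
Proof.
rewrite /generic_f coef_sum (bigD1 i) //= coefZ coefXn eqxx mulr1 big1 ?addr0 // => j ji.
by rewrite coefZ coefXn (inj_eq val_inj) eq_sym (negbTE ji) mulr0.
Qed.

Lemma coef_generic_g (j : 'I_n.+1) : g`_j = 'X_(rshift m.+1 j).
Proof.
rewrite /generic_g coef_sum (bigD1 j) //= coefZ coefXn eqxx mulr1 big1 ?addr0 // => i ij.
by rewrite coefZ coefXn (inj_eq val_inj) eq_sym (negbTE ij) mulr0.
Qed.

Lemma size_generic_f : (size f <= m.+1)%N.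
Proof.
apply: (leq_trans (size_sum _ _ _)); apply/bigmax_leqP => i _.
by apply: (leq_trans (size_scale_leq _ _)); rewrite size_polyXn.
Qed.

Lemma size_generic_g : (size g <= n.+1)%N.
Proof.
apply: (leq_trans (size_sum _ _ _)); apply/bigmax_leqP => i _.
by apply: (leq_trans (size_scale_leq _ _)); rewrite size_polyXn.
Qed.

Definition xword (mo : 'X_{1..N}) : seq nat :=
  flatten [seq nseq (mo (lshift n.+1 i)) (i : nat) | i <- enum 'I_m.+1].
Definition yword (mo : 'X_{1..N}) : seq nat :=
  flatten [seq nseq (mo (rshift m.+1 j)) (j : nat) | j <- enum 'I_n.+1].

Lemma mono_word (mo : 'X_{1..N}) : 'X_[mo] = word f (xword mo) * word g (yword mo) :> S.
Proof.
rewrite mpolyXE_id big_split_ord /=; congr (_ * _).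
  rewrite /word /xword big_flatten big_map big_enum; apply: eq_bigr => i _.
  by rewrite big_nseq -coef_generic_f iter_mulr mulr1.
rewrite /word /yword big_flatten big_map big_enum; apply: eq_bigr => i _.
by rewrite big_nseq -coef_generic_g iter_mulr mulr1.
Qed.

Lemma word_mono (I J : seq nat) : all (leq^~ m) I -> all (leq^~ n) J ->
  exists mo : 'X_{1..N}, [/\ word f I * word g J = 'X_[mo],
    perm_eq I (xword mo) & perm_eq J (yword mo)].
Proof.
have count_word c (I0 : seq nat) (F : 'I_c.+1 -> nat) : all (leq^~ c) I0 ->
    (forall i : 'I_c.+1, F i = count_mem (i : nat) I0) ->
    perm_eq I0 (flatten [seq nseq (F i) (i : nat) | i <- enum 'I_c.+1]).
  move=> cI HF; apply/allP => v _ /=; apply/eqP.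
  rewrite count_flatten -map_comp sumnE big_map big_enum /=.
  under eq_bigr => i _ do rewrite count_nseq /= HF.
  case: (leqP v c) => vc.
    rewrite (bigD1 (Ordinal (vc : (v < c.+1)%N))) //= eqxx mul1n big1 ?addn0 // => i iv.
    by case: eqP => // E; case/eqP: iv; apply: val_inj.
  rewrite big1 => [|i _]; last by have := ltn_ord i; case: eqP => // ->; lia.
  by apply/count_memPn; apply/negP => /(allP cI) /=; lia.
move=> mI nJ.
suff [mo [E HI HJ]] : exists mo : 'X_{1..N}, [/\ word f I * word g J = 'X_[mo] :> S,
    forall i : 'I_m.+1, mo (lshift n.+1 i) = count_mem (i : nat) I
  & forall j : 'I_n.+1, mo (rshift m.+1 j) = count_mem (j : nat) J].
  by exists mo; split=> //; apply: count_word.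
elim: I mI => [_|i I IH /= /andP[im /IH[mo [E HI HJ]]]].
  elim: J nJ => [_|j J IH /= /andP[jn /IH[mo [E HI HJ]]]].
    exists 0%MM; split=> [|i|j]; rewrite ?mnm0E // /word !big_nil mulr1.
    by rewrite mpolyX0.
  exists (mo + U_(rshift m.+1 (Ordinal (jn : (j < n.+1)%N))))%MM; split=> [|i'|j'].
  - rewrite word_cons mulrCA E mulrC mpolyXD; congr (_ * _).
    exact: (coef_generic_g (Ordinal (jn : (j < n.+1)%N))).
  - by rewrite mnmDE mnm1E HI eq_rlshift addn0.
  - by rewrite mnmDE mnm1E HJ addnC eq_rshift -val_eqE.
exists (mo + U_(lshift n.+1 (Ordinal (im : (i < m.+1)%N))))%MM; split=> [|i'|j'].
- rewrite word_cons -mulrA E mulrC mpolyXD; congr (_ * _).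
  exact: (coef_generic_f (Ordinal (im : (i < m.+1)%N))).
- by rewrite mnmDE mnm1E HI addnC eq_lshift -val_eqE.
- by rewrite mnmDE mnm1E HJ eq_lrshift addn0.
Qed.

Lemma word_ind (T : S -> Prop) : is_subgroup T -> (forall c F, T F -> T (c *: F)) ->
  (forall I J, T (word f I * word g J)) -> forall F, T F.
Proof.
move=> TG TZ TW F; rewrite [F]mpolyE; apply: subgroup_sum => // mo _.
by apply: TZ; rewrite mono_word; exact: TW.
Qed.

Definition mono_count (I J : seq nat) : R :=
  if (size I == n) && (size J == m)
  then margin_count R (fun i : 'I_n => nth 0%N I i) (fun j : 'I_m => nth 0%N J j)
  else 0.

(* The Macaulay dual generator of [L]: it is the resultant of [f] and [g],
   read as an element of the divided power algebra. *)
Definition res_form (F : S) : R :=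
  \sum_(mo : 'X_{1..N < (n + m).+1}) F@_mo * mono_count (xword mo) (yword mo).

Lemma res_form_is_linear : linear_for *%R res_form.
Proof.
move=> c F G; rewrite /res_form mulr_sumr -big_split /=; apply: eq_bigr => mo _.
by rewrite mcoeffD mcoeffZ mulrDl mulrA.
Qed.

HB.instance Definition _ := GRing.isLinear.Build R S R *%R res_form res_form_is_linear.

Lemma size_words (mo : 'X_{1..N}) : (size (xword mo) + size (yword mo) = mdeg mo)%N.
Proof.
have sizeE c (F : 'I_c -> nat) : size (flatten [seq nseq (F i) (i : nat) | i <- enum 'I_c]) =
    (\sum_(i < c) F i)%N.
  rewrite size_flatten /shape -map_comp sumnE big_map big_enum /=.
  by apply: eq_bigr => i _; rewrite size_nseq.
by rewrite mdegE big_split_ord /= /xword /yword !sizeE.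
Qed.

(** Indices out of range are covered too: they make the word 0, and no [n] x [m] matrix has a row
    with more than [m] ones or a column with more than [n] zeros. Here the indices bounded are [m]
    for [I] and [n] for [J]. *)
Lemma res_form_word I J : res_form (word f I * word g J) = mono_count I J.
Proof.
have nthP c (s : seq nat) i : (c < i)%N -> i \in s ->
    exists2 l, (l < size s)%N & (c < nth 0 s l)%N.
  by move=> ci iI; exists (index i s); rewrite ?index_mem // nth_index.
have [mI|] := boolP (all (leq^~ m) I); last first.
  move=> /allPn[i iI im]; rewrite (word_perm _ (perm_to_rem iI)) word_cons.
  rewrite nth_default ?mul0r ?raddf0; last by apply: leq_trans size_generic_f _; lia.
  rewrite /mono_count; case: ifP => // /andP[/eqP sI _].
  apply/esym/big_pred0 => E; apply/negbTE/negP => /andP[/forallP H _].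
  have [|l] := nthP m I i _ iI; first by lia.
  by rewrite sI => lI; have := row_ones_le E (Ordinal lI); rewrite (eqP (H _)) /=; lia.
have [nJ|] := boolP (all (leq^~ n) J); last first.
  move=> /allPn[i iI im]; rewrite (word_perm _ (perm_to_rem iI)) word_cons.
  rewrite nth_default ?mul0r ?mulr0 ?raddf0; last by apply: leq_trans size_generic_g _; lia.
  rewrite /mono_count; case: ifP => // /andP[_ /eqP sJ].
  apply/esym/big_pred0 => E; apply/negbTE/negP => /andP[_ /forallP H].
  have [|l] := nthP n J i _ iI; first by lia.
  by rewrite sJ => lI; have := col_zeros_le E (Ordinal lI); rewrite (eqP (H _)) /=; lia.
have [mo [-> pI pJ]] := word_mono mI nJ.
have -> : mono_count I J = mono_count (xword mo) (yword mo).
  rewrite /mono_count -(perm_size pI) -(perm_size pJ).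
  by case: ifP => // /andP[/eqP sI /eqP sJ]; apply: margin_count_perm_eq.
rewrite /res_form; under eq_bigr => mo' _ do rewrite mcoeffX.
case: (ltnP (mdeg mo) (n + m).+1) => h.
  rewrite (bigD1 (BMultinom h)) //= eqxx mul1r big1 ?addr0 // => mo' ne.
  by case: eqP => [E|]; rewrite ?mul0r //; case/eqP: ne; apply: val_inj.
(* Monomials of degree above [n + m] are outside the finite sum defining [res_form]; their
   [mono_count] is 0 by degree. *)
rewrite big1 => [|mo' _]; last first.
  by case: eqP => [E|]; rewrite ?mul0r //; have := bmdeg mo'; rewrite -E; lia.
rewrite /mono_count; case: andP => // -[/eqP sI /eqP sJ].
by have := size_words mo; rewrite sI sJ; lia.
Qed.

Definition link_ideal : set S :=
  ideal_add (ideal_add (content (f * g)) (ideal_exp (content f) n.+1))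
            (ideal_exp (content g) m.+1).
Local Notation L := link_ideal.

Lemma link_is_ideal : is_ideal L.
Proof.
apply: ideal_add_ideal; last exact: ideal_exp_ideal.
by apply: ideal_add_ideal; [exact: content_ideal|exact: ideal_exp_ideal].
Qed.

Lemma link_ideal_min (I0 : set S) : is_ideal I0 -> (forall k, I0 (f * g)`_k) ->
  (forall I, size I = n.+1 -> I0 (word f I)) -> (forall J, size J = m.+1 -> I0 (word g J)) ->
  forall x, L x -> I0 x.
Proof.
move=> HI Hfg Hf Hg _ [_ [x Hx [y Hy <-]] [z Hz <-]]; have [_ HD _] := HI.
apply: (HD); last exact: (content_exp_sub HI Hg Hz).
by apply: HD; [exact: (content_sub HI Hfg Hx)|exact: (content_exp_sub HI Hf Hy)].
Qed.

Lemma content_link x : content (f * g) x -> L x.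
Proof. by move=> ?; apply: ideal_addl; [|apply: ideal_addl] => //; exact: ideal_exp_ideal. Qed.

Lemma wordf_link I : (n < size I)%N -> L (word f I).
Proof.
move=> h; apply: ideal_addl; first exact: ideal_exp_ideal.
by apply: ideal_addr; [exact: content_ideal|exact: word_exp].
Qed.

Lemma wordg_link J : (m < size J)%N -> L (word g J).
Proof.
move=> h; apply: ideal_addr; last exact: word_exp.
by apply: ideal_add_ideal; [exact: content_ideal|exact: ideal_exp_ideal].
Qed.

Lemma res_form_fg k I J : res_form ((f * g)`_k * (word f I * word g J)) = 0.
Proof.
have -> : res_form ((f * g)`_k * (word f I * word g J)) =
    \sum_(i < k.+1) mono_count (nat_of_ord i :: I) ((k - i)%N :: J).
  rewrite coefM mulr_suml raddf_sum /=; apply: eq_bigr => i _.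
  by rewrite mulrACA -!word_cons res_form_word.
rewrite /mono_count /=; case E: (((size I).+1 == n) && ((size J).+1 == m)); last by rewrite big1.
case/andP: E; case: (n) => // n' _; case: (m) => // m' _; exact: margin_count_conv.
Qed.

(** The powers in L contribute words with more than [n] factors from [f] or more than [m] from [g],
    which exceed the bidegree of [res_form]; the content of [f * g] is the cancellation in
    [res_form_fg]. *)
Lemma res_form_link F G : L F -> res_form (F * G) = 0.
Proof.
move=> LF.
have ann_sub (z : S) : is_subgroup (fun F => res_form (z * F) = 0).
  split=> [|x y Hx Hy]; first by rewrite mulr0 raddf0.
  by rewrite mulrBr raddfB /= Hx Hy subrr.
have annP (z : S) : (forall I J, res_form (z * (word f I * word g J)) = 0) ->
    forall G, res_form (z * G) = 0.
  move=> H; apply: word_ind => // c {}G HG.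
  by rewrite -scalerAr linearZ /= HG mulr0.
move: F LF G; apply: (link_ideal_min (I0 := fun F => forall G, res_form (F * G) = 0)).
- split=> [G|x y Hx Hy G|a x Hx G]; first by rewrite mul0r raddf0.
    by rewrite mulrDl raddfD /= Hx Hy addr0.
  by rewrite mulrC mulrA [G * a]mulrC mulrC.
- by move=> k; apply: annP => I J; exact: res_form_fg.
- move=> I sI; apply: annP => I' J'; rewrite mulrA -word_cat res_form_word /mono_count.
  by case: eqP => //; rewrite size_cat; lia.
- move=> J sJ; apply: annP => I' J'; rewrite mulrCA -word_cat res_form_word /mono_count.
  by case: eqP => //; case: eqP => //; rewrite size_cat; lia.
Qed.

(** For dual bases modulo L this operator is the identity modulo L. *)
Definition duals (D : seq (S * S)) (F : S) : S :=
  \sum_(ef <- D) res_form (F * ef.2) *: ef.1.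

Lemma duals_is_linear D : linear (duals D).
Proof.
move=> c F G; rewrite /duals scaler_sumr -big_split /=; apply: eq_bigr => ef _.
by rewrite mulrDl -scalerAl linearP /= scalerDl scalerA.
Qed.

HB.instance Definition _ D := GRing.isLinear.Build R S S *:%R (duals D) (duals_is_linear D).

Lemma duals_sub D : is_subgroup (fun F => L (F - duals D F)).
Proof.
have LG := ideal_subgroup link_is_ideal.
split=> [|x y Hx Hy]; first by rewrite raddf0 subrr; exact: subgroup0 LG.
by rewrite raddfB /=; have := subgroupB LG Hx Hy; congr L; ring.
Qed.

Lemma duals_link D F : L F -> L (F - duals D F).
Proof.
move=> LF; rewrite /duals big1 ?subr0 // => ef _.
by rewrite res_form_link // scale0r.
Qed.

(* Gram-Schmidt for a triangular system of vectors [e.1] and functionals [e.2]. *)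
Lemma triangular_duals (es : seq (S * S)) :
  pairwise (fun e e' : S * S => res_form (e.1 * e'.2) == 0) es ->
  (forall e, e \in es -> exists u, res_form (e.1 * e.2) * u = 1) ->
  exists D, (forall e, e \in es -> duals D e.1 = e.1) /\
            {subset [seq d.2 | d <- D] <= [seq e.2 | e <- es]}.
Proof.
elim/last_ind: es => [|es e IH]; first by exists [::].
rewrite pairwise_rcons => /andP[/allP He Hes] Hu.
have [|D [HD sD]] := IH Hes.
  by move=> e' e'es; apply: Hu; rewrite mem_rcons inE e'es orbT.
have [|u eu] := Hu e; first by rewrite mem_rcons mem_head.
(* The new term vanishes on the earlier vectors, which pair to 0 with [e.2], and on [e.1] it
   supplies exactly the defect [e.1 - duals D e.1]. *)
exists ((u *: (e.1 - duals D e.1), e.2) :: D); split; last first.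
  move=> x; rewrite map_rcons mem_rcons !inE => /orP[->//|/sD ->].
  by rewrite orbT.
move=> e'.
have -> h F : duals (h :: D) F = res_form (F * h.2) *: h.1 + duals D F.
  by rewrite /duals big_cons.
rewrite /= mem_rcons inE => /orP[/eqP->|e'es].
  by rewrite scalerA eu scale1r subrK.
by rewrite (eqP (He _ e'es)) scale0r add0r HD.
Qed.

(** * Dual bases in a single bidegree *)

Section Bidegree.
Variables a b : nat.
Hypotheses (an : (a <= n)%N) (bm : (b <= m)%N).
Implicit Types E : {ffun 'I_n * 'I_m -> bool}.

(** The monomial of the full margins of [E] is split into a head of bidegree [(a, b)] and a tail of
    bidegree [(n - a, m - b)]. *)
Definition head_mono E : S :=
  (\prod_(i < n | (i < a)%N) f`_(row_ones E i)) *
  \prod_(j < m | (j < b)%N) g`_(col_zeros E j).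
Definition tail_mono E : S :=
  (\prod_(i < n | ~~ (i < a)%N) f`_(row_ones E i)) *
  \prod_(j < m | ~~ (j < b)%N) g`_(col_zeros E j).

Lemma res_form_prod (r : 'I_n -> nat) (z : 'I_m -> nat) :
  res_form ((\prod_i f`_(r i)) * \prod_j g`_(z j)) = margin_count R r z.
Proof.
have codE c (F : 'I_c -> nat) (i : 'I_c) : nth 0%N (codom F) i = F i.
  by rewrite (nth_map i) ?size_enum_ord // nth_ord_enum.
have wordE c (F : 'I_c -> nat) (p : {poly S}) : \prod_i p`_(F i) = word p (codom F).
  by rewrite /word big_map big_enum.
rewrite !wordE res_form_word /mono_count !size_codom !card_ord !eqxx /=.
by apply: eq_margin_count => i; rewrite codE.
Qed.

Lemma res_form_head_tail E E' :
  res_form (head_mono E * tail_mono E') = margin_count R (mixed_rows a E E') (mixed_cols b E E').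
Proof.
rewrite -res_form_prod mulrACA; congr (res_form (_ * _)).
  rewrite [RHS](bigID (fun i : 'I_n => (i < a)%N)) /=; congr (_ * _); apply: eq_bigr => i.
    by rewrite /mixed_rows => ->.
  by rewrite /mixed_rows => /negbTE ->.
rewrite [RHS](bigID (fun j : 'I_m => (j < b)%N)) /=; congr (_ * _); apply: eq_bigr => i.
  by rewrite /mixed_cols => ->.
by rewrite /mixed_cols => /negbTE ->.
Qed.

Lemma res_form_tail E I J : (size I, size J) != (a, b) ->
  res_form (word f I * word g J * tail_mono E) = 0.
Proof.
have wordE c d (F : 'I_c -> nat) (p : {poly S}) : (d <= c)%N ->
    exists2 s, size s = (c - d)%N & \prod_(i < c | ~~ (i < d)%N) p`_(F i) = word p s.
  move=> dc; exists (map F (filter (fun i : 'I_c => ~~ (i < d)%N) (enum 'I_c))).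
    rewrite size_map size_filter -sum1_count big_enum_cond big_mkcond /=.
    have := sum_negb_ord (fun i : 'I_c => (i < d)%N); rewrite sum_ltn_ord.
    have -> : (\sum_(i < c) ~~ (i < d) = \sum_(i < c) if ~~ (i < d) then 1 else 0)%N.
      by apply: eq_bigr => i _; case: ifP.
    by lia.
  by rewrite /word big_map big_filter big_enum_cond.
move=> ne; rewrite /tail_mono.
have [s sI ->] := wordE _ _ (row_ones E) f an.
have [t tJ ->] := wordE _ _ (col_zeros E) g bm.
rewrite mulrACA -!word_cat res_form_word /mono_count !size_cat sI tJ.
case: ifP => // /andP[/eqP h1 /eqP h2]; case/eqP: ne; congr (_, _); lia.
Qed.

(** The second clause, which holds because tails have complementary bidegree, keeps the systems of
    different bidegrees from interfering. *)
Lemma bidegree_duals : exists D,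
  (forall I J, size I = a -> size J = b ->
     L (word f I * word g J - duals D (word f I * word g J))) /\
  (forall I J, (size I, size J) != (a, b) -> duals D (word f I * word g J) = 0).
Proof.
pose sh := [seq E <- enum {ffun 'I_n * 'I_m -> bool} | `[< corner_shape a b E >]].
(* Increasing keys: an earlier head pairs to 0 with a later tail, as [triangular_duals] requires. *)
pose ks := sort (fun E E' => shape_key b E <= shape_key b E') sh.
have kshape E : (E \in ks) = `[< corner_shape a b E >].
  by rewrite mem_sort mem_filter mem_enum andbT.
have ku : uniq ks by rewrite sort_uniq filter_uniq // enum_uniq.
have ksrt : pairwise (fun E E' => shape_key b E <= shape_key b E') ks.
  rewrite -sorted_pairwise; last by move=> ? ? ? /= h1; exact: le_trans h1.
  by apply: sort_sorted => x y; exact: le_total.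
have [||D [HD sD]] := @triangular_duals [seq (head_mono E, tail_mono E) | E <- ks].
- rewrite pairwise_map.
  have : pairwise [rel E E' | (shape_key b E <= shape_key b E') && (E != E')] ks.
    by rewrite pairwise_relI ksrt -uniq_pairwise.
  apply: (sub_in_pairwise (P := mem ks)); last by apply/allP.
  move=> E E' /=; rewrite !kshape => /asboolP sE /asboolP sE' /andP[le ne].
  by rewrite res_form_head_tail mixed_margin_count0.
- move=> ? /mapP[E]; rewrite kshape => /asboolP sE -> /=.
  exists (msign R E); rewrite res_form_head_tail mixed_margin_countE //.
  by rewrite /msign -expr2 sqrr_sign.
exists D; split; last first.
  move=> I J ne; rewrite /duals big_seq big1 // => d dD.
  have /sD : d.2 \in [seq d.2 | d <- D] by exact: map_f.
  by rewrite -map_comp => /mapP[E _ ->]; rewrite /= res_form_tail // scale0r.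
move=> I J sI sJ.
(* [duals D] kills L, so the words reproduced modulo L form a subgroup containing the content of
   [f * g]; only standard words remain to be checked. *)
apply: (straightening size_generic_f size_generic_g an bm (duals_sub D) _ _ sI sJ).
  by move=> x /content_link; exact: duals_link.
move=> {sI sJ}I {}J sI sJ bI bJ.
have [E [I' [J' [sE pI pJ rE zE]]]] := shape_exists an bm sI sJ bI bJ.
have -> : word f I * word g J = head_mono E.
  rewrite (word_perm _ pI) (word_perm _ pJ) /head_mono; congr (_ * _).
    rewrite /word (big_nth 0%N) big_mkord -(perm_size pI) sI
      (big_ord_widen n (fun i => f`_(nth 0%N I' i))) //.
    by apply: eq_bigr => i ia; rewrite rE.
  rewrite /word (big_nth 0%N) big_mkord -(perm_size pJ) sJ
    (big_ord_widen m (fun j => g`_(nth 0%N J' j))) //.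
  by apply: eq_bigr => i ia; rewrite zE.
rewrite (HD (head_mono E, tail_mono E)) ?subrr; first exact: subgroup0 (ideal_subgroup link_is_ideal).
by apply: map_f; rewrite kshape; apply/asboolP.
Qed.

End Bidegree.

Lemma link_scale c F : L F -> L (c *: F).
Proof. by have [_ _ LM] := link_is_ideal; rewrite -mul_mpolyC; exact: LM. Qed.

(* The pairs in [D] are dual bases for the pairing on S/L given by [res_form]. *)
Lemma perfect_duality : exists D, forall F, L (F - duals D F).
Proof.
have [_ _ LM] := link_is_ideal.
pose ab := [seq (a, b) | a <- iota 0 n.+1, b <- iota 0 m.+1].
have abP a b : ((a, b) \in ab) = (a <= n)%N && (b <= m)%N.
  apply/allpairsP/andP => [[[a' b'] [+ + [-> ->]]]|[an bm]].
    by rewrite !mem_iota /=; lia.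
  by exists (a, b); rewrite !mem_iota /=; split=> //; lia.
suff [D HD] : exists D, forall I J, (size I, size J) \in ab ->
    L (word f I * word g J - duals D (word f I * word g J)).
  exists D; apply: word_ind => [|c F HF|I J]; first exact: duals_sub.
    by rewrite linearZ /= -scalerBr; exact: link_scale.
  case: (boolP ((size I, size J) \in ab)) => [|h]; first exact: HD.
  apply: duals_link; move: h; rewrite abP negb_and -!ltnNge => /orP[h|h].
    by rewrite mulrC; apply/LM/wordf_link.
  exact/LM/wordg_link.
have : uniq ab by rewrite allpairs_uniq ?iota_uniq // => -[? ?] [? ?].
have : {subset ab <= ab} by [].
suff H s : {subset s <= ab} -> uniq s -> exists D,
    (forall I J, (size I, size J) \in s ->
      L (word f I * word g J - duals D (word f I * word g J))) /\
    (forall I J, (size I, size J) \notin s -> duals D (word f I * word g J) = 0).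
  by move=> h u; have [D [HD _]] := H ab h u; exists D.
elim: s => [_ _|[a b] s IH sub /= /andP[abs us]].
  by exists [::]; split=> // I J _; rewrite /duals big_nil.
have /andP[an bm] : (a <= n)%N && (b <= m)%N by rewrite -abP sub ?mem_head.
have [D [D1 D2]] := IH (fun x xs => sub x (mem_behead (s := _ :: _) xs)) us.
have [D' [D1' D2']] := bidegree_duals an bm.
have catE F : duals (D' ++ D) F = duals D' F + duals D F by rewrite /duals big_cat.
(* On the words of one bidegree only the system of that bidegree acts, so concatenation keeps both
   properties. *)
exists (D' ++ D); split=> I J; rewrite inE catE.
  case: eqP => [[sI sJ] _|/eqP ne /= h]; last by rewrite D2' // add0r; exact: D1.
  by rewrite D2 ?addr0; [exact: D1'|rewrite sI sJ].
by rewrite negb_or => /andP[ne ns]; rewrite D2' // D2 // addr0.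
Qed.

(** For such [F] every coefficient of [duals D F] vanishes. *)
Lemma res_form_ann F : (forall G, res_form (F * G) = 0) -> L F.
Proof.
have [D HD] := perfect_duality => H; have := HD F.
by rewrite /duals big1 ?subr0 // => d _; rewrite H scale0r.
Qed.

Lemma res_form_neq0 : exists F, res_form F = 1.
Proof.
have [s1 s2] : size (nseq n m) == n /\ size (nseq m 0%N) == m by rewrite !size_nseq.
(* This is [x_m^n y_0^m]: only the choice of [t_i] in every factor [t_i - s_j] produces the
   corresponding term. *)
exists (word f (nseq n m) * word g (nseq m 0%N)).
rewrite res_form_word /mono_count s1 s2 /margin_count.
pose E0 : {ffun 'I_n * 'I_m -> bool} := [ffun=> true].
have z0 j : col_zeros E0 j = 0%N by rewrite /col_zeros big1 // => i _; rewrite ffunE.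
rewrite (big_pred1 E0) => [|E /=].
  by rewrite /msign big1.
apply/idP/eqP => [/andP[/forallP Er _]|->].
  apply/ffunP => -[i j]; rewrite ffunE.
  have := sum_negb_ord (fun j => E (i, j)); have := eqP (Er i).
  rewrite /row_ones nth_nseq ltn_ord => -> /eqP.
  rewrite -[X in _ == X]addn0 eqn_add2l => /eqP H.
  by apply/negPn/negP => h; move: H; rewrite (bigD1 j) //= h.
apply/andP; split; apply/forallP => i; rewrite nth_nseq ltn_ord ?z0 //.
by apply/eqP; rewrite /row_ones; under eq_bigr => j _ do rewrite ffunE; rewrite sum1_card card_ord.
Qed.

End Functional.

(** * Primary ideals and the intersection *)

Lemma ideal_exp_power (A : comNzRingType) (I : set A) x k : I x -> ideal_exp I k (x ^+ k).
Proof.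
move=> Ix; elim: k => // k IH; rewrite exprS.
by apply: mem_ideal_gen; exists x => //; exists (x ^+ k).
Qed.

Lemma ideal_exp_power_le (A : comNzRingType) (I : set A) x k l :
  (k <= l)%N -> I x -> ideal_exp I k (x ^+ l).
Proof.
move=> kl Ix; rewrite -(subnK kl) exprD; have [_ _ IM] := ideal_exp_ideal I k.
by apply: IM; exact: ideal_exp_power.
Qed.

(** The hypotheses make [I] the kernel of an endomorphism of a domain, so it is even prime. *)
Lemma primary_retract (A : idomainType) (I : set A) (t : {rmorphism A -> A}) :
  is_ideal I -> (forall x, I x -> t x = 0) -> (forall x, I (x - t x)) -> primary_ideal I.
Proof.
move=> HI It tI; split=> // [/It /eqP|a b /It /eqP].
  by rewrite rmorph1 oner_eq0.
rewrite rmorphM mulf_eq0 => /orP[/eqP t0|/eqP t0].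
  by left; have := tI a; rewrite t0 subr0.
by right; exists 1%N; have := tI b; rewrite t0 subr0.
Qed.

(** On the [k]-th power of [content p] the map [t] is the identity modulo [content (p * q)]: [t]
    fixes products of coefficients of [p], and a multiplier changes only by an element of
    [content q], which Dedekind-Mertens absorbs. *)
Lemma dedekind_mertens_retract (A : comNzRingType) (p q : {poly A}) (t : {rmorphism A -> A}) k :
  (size q <= k)%N -> (forall i, t p`_i = p`_i) -> (forall a, content q (a - t a)) ->
  forall x, ideal_exp (content p) k x -> t x = 0 -> content (p * q) x.
Proof.
move=> sq tp tq x Ex tx.
have [C0 CD CM] := content_ideal (p * q).
(* The second condition makes [I0] an ideal, through [a x - t (a x) = t a (x - t x) + (a - t a)
   x]. *)
pose I0 : set A := fun x => content (p * q) (x - t x) /\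
  forall y, content q y -> content (p * q) (y * x).
suff: I0 x by rewrite /I0 tx subr0 => -[].
apply: (content_exp_sub _ _ Ex) => {x Ex tx}.
  split.
  - by split=> [|y _]; rewrite ?rmorph0 ?subr0 ?mulr0.
  - move=> x y [Ix Jx] [Iy Jy]; split=> [|z Cz].
      by rewrite rmorphD opprD addrACA; exact: CD.
    by rewrite mulrDr; apply: CD; [exact: Jx|exact: Jy].
  - move=> a x [Ix Jx]; split=> [|z Cz]; last by rewrite mulrCA; apply: CM; exact: Jx.
    have -> : a * x - t (a * x) = t a * (x - t x) + (a - t a) * x by rewrite rmorphM; ring.
    by apply: CD; [exact: CM|exact: Jx].
move=> s sk; split=> [|y].
  have -> : t (word p s) = word p s by rewrite rmorph_prod; apply: eq_bigr => i _; exact: tp.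
  by rewrite subrr.
apply: (content_sub (I := fun y => content (p * q) (y * word p s))); first split.
- by rewrite mul0r.
- by move=> u v; rewrite mulrDl; exact: CD.
- by move=> u v; rewrite -mulrA; exact: CM.
by move=> i; have := @dedekind_mertens A q p k i s sq sk; rewrite [q * p]mulrC.
Qed.

(** * Specializing variables to 0, and nilpotency modulo L *)

Section Specialization.
Variables (R : comNzRingType) (m n : nat).
Local Notation N := (m.+1 + n.+1)%N.
Local Notation S := {mpoly R[N]}.
Local Notation f := (generic_f R m n : {poly S}).
Local Notation g := (generic_g R m n : {poly S}).
Local Notation L := (@link_ideal R m n).

Definition kill_x : S -> S :=
  comp_mpoly [tuple if split k is inl _ then 0 else 'X_k | k < N].
Definition kill_y : S -> S :=
  comp_mpoly [tuple if split k is inl _ then 'X_k else 0 | k < N].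
Definition constant_term : S -> R := meval (fun=> 0).

HB.instance Definition _ := GRing.RMorphism.on kill_x.
HB.instance Definition _ := GRing.RMorphism.on kill_y.
HB.instance Definition _ := GRing.RMorphism.on constant_term.

Lemma coef_f_ind (P : S -> Prop) i : P 0 -> (forall i : 'I_m.+1, P 'X_(lshift n.+1 i)) -> P f`_i.
Proof.
move=> P0 PX; case: (ltnP i m.+1) => im; last first.
  by rewrite nth_default //; apply: leq_trans (size_generic_f _ _ _) im.
by have := PX (Ordinal im); rewrite -coef_generic_f.
Qed.

Lemma coef_g_ind (P : S -> Prop) j : P 0 -> (forall j : 'I_n.+1, P 'X_(rshift m.+1 j)) -> P g`_j.
Proof.
move=> P0 PX; case: (ltnP j n.+1) => jn; last first.
  by rewrite nth_default //; apply: leq_trans (size_generic_g _ _ _) jn.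
by have := PX (Ordinal jn); rewrite -coef_generic_g.
Qed.

Lemma kill_xf i : kill_x f`_i = 0.
Proof.
apply: (coef_f_ind (P := fun F => kill_x F = 0)) => [|{}i]; first exact: rmorph0.
by rewrite /kill_x comp_mpolyXU -tnth_nth tnth_mktuple -[lshift n.+1 i]/(unsplit (inl i)) unsplitK.
Qed.

Lemma kill_xg j : kill_x g`_j = g`_j.
Proof.
apply: (coef_g_ind (P := fun F => kill_x F = F)) => [|{}j]; first exact: rmorph0.
by rewrite /kill_x comp_mpolyXU -tnth_nth tnth_mktuple -[rshift m.+1 j]/(unsplit (inr j)) unsplitK.
Qed.

Lemma kill_yf i : kill_y f`_i = f`_i.
Proof.
apply: (coef_f_ind (P := fun F => kill_y F = F)) => [|{}i]; first exact: rmorph0.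
by rewrite /kill_y comp_mpolyXU -tnth_nth tnth_mktuple -[lshift n.+1 i]/(unsplit (inl i)) unsplitK.
Qed.

Lemma kill_yg j : kill_y g`_j = 0.
Proof.
apply: (coef_g_ind (P := fun F => kill_y F = 0)) => [|{}j]; first exact: rmorph0.
by rewrite /kill_y comp_mpolyXU -tnth_nth tnth_mktuple -[rshift m.+1 j]/(unsplit (inr j)) unsplitK.
Qed.

Lemma constant_termf i : constant_term f`_i = 0.
Proof.
apply: (coef_f_ind (P := fun F => constant_term F = 0)) => [|{}i]; first exact: rmorph0.
by rewrite /constant_term mevalXU.
Qed.

Lemma constant_termg j : constant_term g`_j = 0.
Proof.
apply: (coef_g_ind (P := fun F => constant_term F = 0)) => [|{}j]; first exact: rmorph0.
by rewrite /constant_term mevalXU.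
Qed.

Lemma rmorph_kernel_ideal (B C : comNzRingType) (t : {rmorphism B -> C}) :
  is_ideal (fun F => t F = 0).
Proof.
split=> [|x y Hx Hy|a x Hx]; first exact: rmorph0.
  by rewrite rmorphD Hx Hy addr0.
by rewrite rmorphM Hx mulr0.
Qed.

Lemma kill_x_content F : content f F -> kill_x F = 0.
Proof.
move: F; apply: (content_sub (rmorph_kernel_ideal kill_x)); exact: kill_xf.
Qed.

Lemma kill_y_content F : content g F -> kill_y F = 0.
Proof.
move: F; apply: (content_sub (rmorph_kernel_ideal kill_y)); exact: kill_yg.
Qed.

Lemma subr_retract (I0 : set S) (t : S -> S) : is_ideal I0 -> linear t ->
  (forall I J, I0 (word f I * word g J - t (word f I * word g J))) -> forall F, I0 (F - t F).
Proof.
move=> HI lt Hw; have [_ _ IM] := HI.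
pose tl : {linear S -> S} := HB.pack t (GRing.isLinear.Build R S S _ t lt).
have t0 : t 0 = 0 := raddf0 tl.
have tB x y : t (x - y) = t x - t y := raddfB tl x y.
have tZ c x : t (c *: x) = c *: t x := linearZ_LR tl c x.
apply: word_ind => // [|c F HF].
  split=> [|x y Hx Hy]; first by rewrite t0 subrr; exact: subgroup0 (ideal_subgroup HI).
  by rewrite tB; have := subgroupB (ideal_subgroup HI) Hx Hy; congr I0; ring.
by rewrite tZ -scalerBr -mul_mpolyC; exact: IM.
Qed.

Lemma kill_x_retract F : content f (F - kill_x F).
Proof.
have CI := content_ideal f; have [C0 _ CM] := CI.
apply: subr_retract => // [c u v|[|i I] J]; first by rewrite /kill_x linearP.
  rewrite {1 3}/word big_nil !mul1r.
  have -> : kill_x (word g J) = word g J; last by rewrite subrr.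
  by rewrite rmorph_prod; apply: eq_bigr => j _; exact: kill_xg.
rewrite word_cons !rmorphM /= kill_xf !mul0r subr0 -mulrA mulrC.
by apply: CM; exact: mem_content.
Qed.

Lemma kill_y_retract F : content g (F - kill_y F).
Proof.
have CI := content_ideal g; have [C0 _ CM] := CI.
apply: subr_retract => // [c u v|I [|j J]]; first by rewrite /kill_y linearP.
  rewrite {2 4}/word big_nil !mulr1.
  have -> : kill_y (word f I) = word f I; last by rewrite subrr.
  by rewrite rmorph_prod; apply: eq_bigr => j _; exact: kill_yf.
rewrite word_cons !rmorphM /= kill_yg mul0r mulr0 subr0 mulrCA mulrC.
by apply: CM; exact: mem_content.
Qed.

Lemma constant_term_retract F :
  ideal_add (content f) (content g) (F - (constant_term F)%:MP).
Proof.
have CI : is_ideal (ideal_add (content f) (content g)).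
  by apply: ideal_add_ideal; exact: content_ideal.
have [C0 _ CM] := CI.
move: F; apply: (subr_retract (t := fun F => (constant_term F)%:MP)) => //.
  by move=> c u v; rewrite /constant_term mevalD mevalZ mpolyCD mpolyCM mul_mpolyC.
move=> [|i I] [|j J].
- by rewrite /word !big_nil mulr1 rmorph1 mpolyC1 subrr.
- rewrite word_cons !rmorphM /= constant_termg mpolyC0 mul0r mulr0 subr0 mulrCA mulrC.
  by apply: CM; apply: ideal_addr; [exact: content_ideal|exact: mem_content].
- rewrite word_cons !rmorphM /= constant_termf mpolyC0 !mul0r subr0 -mulrA mulrC.
  by apply: CM; apply: ideal_addl; [exact: content_ideal|exact: mem_content].
- rewrite word_cons !rmorphM /= constant_termf mpolyC0 !mul0r subr0 -mulrA mulrC.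
  by apply: CM; apply: ideal_addl; [exact: content_ideal|exact: mem_content].
Qed.

(** In the binomial expansion of [(p + q) ^+ (n + m).+1], with [p] in [content f] and [q] in
    [content g], each term has more than [n] factors [p] or more than [m] factors [q]. *)
Lemma nilpotent_mod_link F : L ((F - (constant_term F)%:MP) ^+ (n + m).+1).
Proof.
have [_ LD LM] := @link_is_ideal R m n.
have [p Hp [q Hq <-]] := constant_term_retract F.
rewrite exprDn; apply: ideal_sum => [|i _]; first exact: link_is_ideal.
rewrite -mulr_natl; apply: (LM); case: (leqP i m) => im.
  rewrite mulrC; apply: (LM); apply: ideal_addl; first exact: ideal_exp_ideal.
  apply: ideal_addr; first exact: content_ideal.
  by apply: ideal_exp_power_le => //; lia.
apply: LM; apply: ideal_addr; last exact: ideal_exp_power_le.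
by apply: ideal_add_ideal; [exact: content_ideal|exact: ideal_exp_ideal].
Qed.

(** Write [F = c + d] with [d] nilpotent modulo L; [c + d] divides [c^k - (-d)^k] by the geometric
    sum. *)
Lemma constant_term_power F :
  exists G, L (F * G - (constant_term F ^+ (n + m).+1)%:MP).
Proof.
have := nilpotent_mod_link F; move: (constant_term F) (n + m).+1 => c k; set d := F - _ => Ld.
exists (\sum_(i < k) c%:MP ^+ (k.-1 - i) * (- d) ^+ i).
have {1}-> : F = c%:MP - (- d) by rewrite opprK addrC subrK.
rewrite -subrXX rmorphXn /=.
have -> : c%:MP ^+ k - (- d) ^+ k - c%:MP ^+ k = (- (- 1) ^+ k) * d ^+ k :> S.
  by rewrite -[- d]mulN1r exprMn; ring.
by have [_ _ LM] := @link_is_ideal R m n; exact: LM.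
Qed.

Lemma link_proper : ~ L 1.
Proof.
have [F F1] := res_form_neq0 R m n.
by move=> /(@res_form_link _ _ _ _ F) /eqP; rewrite mul1r F1 oner_eq0.
Qed.

(** Write [F = p + q + r] along L. Killing the [y_j] annihilates [F], [p] and [r], hence [q];
    killing the [x_i] annihilates [F], [p] and [q], hence [r]. Then [dedekind_mertens_retract]
    applies to [q] and [r] separately. *)
Lemma content_decomposition F :
  content f F -> content g F -> L F -> content (f * g) F.
Proof.
move=> Ff Fg [_ [p Hp [q Hq <-]] [r Hr EF]].
have [C0 CD CM] := content_ideal (f * g).
have kq : kill_x q = 0.
  apply: (content_exp_sub (rmorph_kernel_ideal kill_x) _ Hq) => -[|i s] // _.
  by rewrite word_cons rmorphM /= kill_xf mul0r.
have kr : kill_y r = 0.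
  apply: (content_exp_sub (rmorph_kernel_ideal kill_y) _ Hr) => -[|i s] // _.
  by rewrite word_cons rmorphM /= kill_yg mul0r.
have kq' : kill_y q = 0.
  have := kill_y_content Fg; rewrite -EF !rmorphD /= kr addr0.
  by rewrite (kill_y_content (F := p)) ?add0r //; move: Hp; rewrite mulrC; exact: content_mull.
have kr' : kill_x r = 0.
  have := kill_x_content Ff; rewrite -EF !rmorphD /= kq addr0.
  by rewrite (kill_x_content (F := p)) ?add0r //; exact: content_mull Hp.
rewrite -EF; apply: (CD); first apply: CD => //.
  by apply: (dedekind_mertens_retract (t := kill_y) (size_generic_g R m n)
    kill_yf kill_y_retract Hq).
rewrite mulrC.
by apply: (dedekind_mertens_retract (t := kill_x) (size_generic_f R m n)
  kill_xg kill_x_retract Hr).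
Qed.

End Specialization.

(** If the constant term of [b] is 0, [b] is nilpotent modulo L. Otherwise [b] divides a nonzero
    constant modulo L, and such a constant can be cancelled because [res_form] is R-linear into a
    domain and detects L. *)
Lemma link_primary (R : idomainType) m n : primary_ideal (@link_ideal R m n).
Proof.
have [L0 LD LM] := @link_is_ideal R m n.
split=> [||a b Lab]; [exact: link_is_ideal|exact: link_proper|].
have [c0|c0] := eqVneq (constant_term b) 0.
  right; exists (n + m).+1; have := nilpotent_mod_link b.
  by rewrite c0 mpolyC0 subr0.
left; apply: res_form_ann => G.
have [H LH] := constant_term_power b.
have : @link_ideal R m n (a * (constant_term b ^+ (n + m).+1)%:MP).
  have -> : a * (constant_term b ^+ (n + m).+1)%:MP =
    H * (a * b) + (- a) * (b * H - (constant_term b ^+ (n + m).+1)%:MP) by ring.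
  by apply: LD; exact: LM.
move=> /(@res_form_link _ _ _ _ G) /eqP.
rewrite [a * _]mulrC mul_mpolyC -scalerAl linearZ /= mulf_eq0 expf_eq0 (negbTE c0) andbF.
by move=> /eqP.
Qed.

(** * Injective dimension of Frobenius extensions *)

(** An alias tagged by [k], so that the [C]-module instance does not collide with the structure of
    [M] over [B]. *)
Definition restrict_scalars (C B : comNzRingType) (k : {rmorphism C -> B})
  (M : lmodType B) : Type := M.

Section Restriction.
Variables (C B : comNzRingType) (k : {rmorphism C -> B}) (M : lmodType B).

Local Notation Mk := (restrict_scalars k M).
HB.instance Definition _ := GRing.Zmodule.on Mk.

Definition rscale (c : C) (x : Mk) : Mk := k c *: (x : M).

Lemma rscaleA a b x : rscale a (rscale b x) = rscale (a * b) x.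
Proof. by rewrite /rscale rmorphM scalerA. Qed.
Lemma rscale1 : left_id 1 rscale.
Proof. by move=> x; rewrite /rscale rmorph1 scale1r. Qed.
Lemma rscaleDr : right_distributive rscale +%R.
Proof. by move=> a x y; rewrite /rscale scalerDr. Qed.
Lemma rscaleDl x : {morph rscale^~ x : a b / a + b}.
Proof. by move=> a b; rewrite /rscale rmorphD scalerDl. Qed.

HB.instance Definition _ :=
  GRing.Zmodule_isLmodule.Build C Mk rscaleA rscale1 rscaleDr rscaleDl.
End Restriction.

Section LinearPack.
Variables (B : comNzRingType) (M N : lmodType B) (h : M -> N).

Definition linear_pack (hl : linear h) : {linear M -> N} :=
  HB.pack h (GRing.isLinear.Build B M N _ h hl).
End LinearPack.

Section Coinduction.
Variables (C B : comNzRingType) (k : {rmorphism C -> B}) (E : lmodType C).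

Definition semilin (h : B -> E) : Prop := forall c x y, h (k c * x + y) = c *: h x + h y.

(** Hom_C(B, E), with linearity expressed through [k]; [B] acts by multiplication on the
    argument. *)
Definition coind : Type := {h : B -> E | `[< semilin h >]}.
HB.instance Definition _ := Choice.on coind.

Definition cfun (h : coind) : B -> E := sval h.
Definition mk_coind (h : B -> E) (hl : semilin h) : coind := exist _ h (introT (asboolP _) hl).

Lemma coindP (h : coind) : semilin (cfun h).
Proof. exact: (elimT (asboolP _) (svalP h)). Qed.

Lemma coind_eq (h h' : coind) : cfun h =1 cfun h' -> h = h'.
Proof. by move=> e; apply: val_inj; apply: funext. Qed.

Lemma coindD_subproof (h h' : coind) : semilin (fun x => cfun h x + cfun h' x).
Proof. by move=> c x y; rewrite !coindP scalerDr addrACA. Qed.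
Lemma coindN_subproof (h : coind) : semilin (fun x => - cfun h x).
Proof. by move=> c x y; rewrite !coindP opprD scalerN. Qed.
Lemma coind0_subproof : semilin (fun _ => 0).
Proof. by move=> c x y; rewrite scaler0 addr0. Qed.
Lemma coindZ_subproof (b : B) (h : coind) : semilin (fun x => cfun h (x * b)).
Proof. by move=> c x y; rewrite mulrDl -mulrA coindP. Qed.

Definition coindD h h' := mk_coind (coindD_subproof h h').
Definition coindN h := mk_coind (coindN_subproof h).
Definition coind0 := mk_coind coind0_subproof.
Definition coindZ b h := mk_coind (coindZ_subproof b h).

Lemma coindDA : associative coindD.
Proof. by move=> x y z; apply: coind_eq => u; rewrite /cfun /= addrA. Qed.
Lemma coindDC : commutative coindD.
Proof. by move=> x y; apply: coind_eq => u; rewrite /cfun /= addrC. Qed.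
Lemma coind0D : left_id coind0 coindD.
Proof. by move=> x; apply: coind_eq => u; rewrite /cfun /= add0r. Qed.
Lemma coindND : left_inverse coind0 coindN coindD.
Proof. by move=> x; apply: coind_eq => u; rewrite /cfun /= addNr. Qed.
HB.instance Definition _ := GRing.isZmodule.Build coind coindDA coindDC coind0D coindND.

Lemma cfunDr h x y : cfun h (x + y) = cfun h x + cfun h y.
Proof. by have := coindP h 1 x y; rewrite rmorph1 mul1r scale1r. Qed.

Lemma cfun0r h : cfun h 0 = 0.
Proof. by apply: (addrI (cfun h 0)); rewrite -cfunDr !addr0. Qed.

Lemma cfunZr h c x : cfun h (k c * x) = c *: cfun h x.
Proof. by have := coindP h c x 0; rewrite cfun0r !addr0. Qed.

Lemma coindZA a b h : coindZ a (coindZ b h) = coindZ (a * b) h.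
Proof. by apply: coind_eq => u; rewrite /cfun /= -mulrA. Qed.
Lemma coindZ1 : left_id 1 coindZ.
Proof. by move=> h; apply: coind_eq => u; rewrite /cfun /= mulr1. Qed.
Lemma coindZDr : right_distributive coindZ +%R.
Proof. by move=> b h h'; apply: coind_eq. Qed.
Lemma coindZDl h : {morph coindZ^~ h : a b / a + b}.
Proof. by move=> a b; apply: coind_eq => u; rewrite /cfun /= mulrDr [LHS]cfunDr. Qed.
HB.instance Definition _ := GRing.Zmodule_isLmodule.Build B coind coindZA coindZ1 coindZDr coindZDl.

Lemma cfunD h h' x : cfun (h + h') x = cfun h x + cfun h' x. Proof. by []. Qed.
Lemma cfunZ b h x : cfun (b *: h) x = cfun h (x * b). Proof. by []. Qed.

Lemma cfun_sum h (I : Type) (r : seq I) (F : I -> B) :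
  cfun h (\sum_(i <- r) F i) = \sum_(i <- r) cfun h (F i).
Proof.
elim: r => [|i r IH]; first by rewrite !big_nil cfun0r.
by rewrite !big_cons cfunDr IH.
Qed.

(** Coinduction is right adjoint to restriction of scalars, which preserves injections. Evaluation
    at 1 transposes a map into [coind], and [y |-> (b |-> g' (b *: y))] transposes back. *)
Lemma coind_injective : injective_module E -> injective_module coind.
Proof.
move=> injE M N i h iI.
pose i' : restrict_scalars k M -> restrict_scalars k N := i.
have il : linear i' by move=> c x y; rewrite /i' linearP.
pose h' (x : restrict_scalars k M) : E := cfun (h x) 1.
have hl : linear h'.
  by move=> c x y; rewrite /h' linearP cfunD cfunZ mul1r -[k c]mulr1 cfunZr.
have [g' g'E] := injE _ _ (linear_pack il) (linear_pack hl) iI.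
have gsub (y : N) : semilin (fun b => g' (b *: y : N)).
  move=> c x z; rewrite -(linearP g' c (x *: y : restrict_scalars k N) (z *: y)).
  by congr (g' _); rewrite scalerDl -scalerA.
pose g (y : N) : coind := mk_coind (gsub y).
have gl : linear g.
  move=> b x y; apply: coind_eq => u; rewrite cfunD cfunZ /cfun /= scalerDr scalerA.
  exact: (raddfD g').
exists (linear_pack gl) => x; apply: coind_eq => b.
rewrite /cfun /=; have := g'E (b *: x : M); rewrite /= /i' /h' linearZ /= => ->.
by rewrite linearZ cfunZ mul1r.
Qed.

End Coinduction.

Section Frobenius.
Variables (C B : comNzRingType) (k : {rmorphism C -> B}) (Phi : B -> C) (D : seq (B * B)).
Hypothesis Phi_lin : forall c x y, Phi (k c * x + y) = c * Phi x + Phi y.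
Hypothesis dualD : forall b, b = \sum_(d <- D) k (Phi (b * d.2)) * d.1.

(** Dual bases make B a finite projective C-module, so Hom_C(B, -) is exact, and [b |-> Phi (_ * b)]
    identifies B with Hom_C(B, C). *)
Lemma frobenius_injective_dimension :
  finite_injective_dimension C^o -> finite_injective_dimension B^o.
Proof.
move=> [n [E [e [d [injE zE injectE ex0 exS]]]]].
have dsub j (h : coind k (E j)) : semilin k (fun x => d j (cfun h x)).
  by move=> c x y; rewrite coindP linearP.
pose d' j (h : coind k (E j)) : coind k (E j.+1) := mk_coind (dsub j h).
have d'l j : linear (d' j).
  by move=> b h h'; apply: coind_eq => u; rewrite /cfun /= -[LHS]/(d j (_ + _)) linearD.
have esub (b : B^o) : semilin k (fun x => e (Phi (x * b) : C^o)).
  by move=> c x y; rewrite mulrDl -mulrA Phi_lin -linearP.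
pose e' (b : B^o) : coind k (E 0%N) := mk_coind (esub b).
have PhiD x y : Phi (x + y) = Phi x + Phi y.
  by have := Phi_lin 1 x y; rewrite rmorph1 !mul1r.
have e'l : linear e'.
  move=> b x y; apply: coind_eq => u; rewrite cfunD cfunZ /cfun /= -(raddfD e).
  by rewrite mulrDr PhiD mulrA.
have lift j (h : coind k (E j.+1)) :
    (forall y, d j.+1 y = 0 <-> exists x, d j x = y) ->
    d' j.+1 h = 0 -> exists h', d' j h' = h.
  move=> exj h0.
  have [u uE] : {u : B -> E j & forall x, d j (u x) = cfun h x}.
    apply: (@boolp.choice _ _ (fun x y => d j y = cfun h x)) => x.
    by apply/exj; have := congr1 (fun h => cfun h x) h0.
  (* Preimages are used only at the [i.1]; the coordinates [Phi (x * i.2)] extend them linearly, as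
     [u] itself need not be linear. *)
  have hs : semilin k (fun x => \sum_(i <- D) Phi (x * i.2) *: u i.1).
    move=> c x y; rewrite scaler_sumr -big_split /=; apply: eq_bigr => i _.
    by rewrite mulrDl -mulrA Phi_lin scalerDl scalerA.
  exists (mk_coind hs); apply: coind_eq => x; rewrite /cfun /= linear_sum /=.
  rewrite -/(cfun h x) [in RHS](dualD x) cfun_sum; apply: eq_bigr => i _.
  by rewrite linearZ /= uE cfunZr.
exists n, (fun j => coind k (E j)), (linear_pack e'l), (fun j => linear_pack (d'l j)).
split=> [j|j nj h|x y|h|j h] /=.
- exact: coind_injective.
- by apply: coind_eq => x; exact: zE.
- move=> /(congr1 (fun h => cfun h)) exy; rewrite [x]dualD [y]dualD.
  apply: eq_bigr => i _; congr (k _ * _); apply: injectE.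
  by have := congr1 (fun h => h i.2) exy; rewrite /cfun /= ![i.2 * _]mulrC.
- split=> [h0|[x <-]]; last first.
    by apply: coind_eq => u; apply/ex0; exists (Phi (u * x)).
  have [u uE] : {u : B -> C & forall x, e (u x : C^o) = cfun h x}.
    apply: (@boolp.choice _ _ (fun x y => e (y : C^o) = cfun h x)) => x.
    by apply/ex0; have := congr1 (fun h => cfun h x) h0.
  (* The dual expansion: the [i.2] carry the values of the functional at the [i.1]. *)
  exists (\sum_(i <- D) k (u i.1) * i.2); apply: coind_eq => x.
  have Phi0 : Phi 0 = 0 by apply: (addrI (Phi 0)); rewrite -PhiD !addr0.
  have Phi_sum (F : B * B -> B) r : Phi (\sum_(i <- r) F i) = \sum_(i <- r) Phi (F i).
    by elim: r => [|i r IH]; rewrite ?big_nil // !big_cons PhiD IH.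
  have PhiZ c y : Phi (k c * y) = c * Phi y.
    by have := Phi_lin c y 0; rewrite Phi0 !addr0.
  rewrite /cfun /= mulr_sumr Phi_sum raddf_sum /= -/(cfun h x) [in RHS](dualD x) cfun_sum.
  apply: eq_bigr => i _; rewrite cfunZr -uE -linearZ /=; congr (e _).
  by rewrite mulrCA PhiZ mulrC.
- split=> [h0|[x <-]]; first exact: lift (exS j) h0.
  by apply: coind_eq => u; apply/exS; exists (cfun x u).
Qed.

End Frobenius.

(** * Noetherianity of module-finite algebras *)

Section NoetherianFinite.
Variables (R A : comNzRingType) (iota : {rmorphism R -> A}).

Fixpoint rspan (s : seq A) (x : A) : Prop :=
  if s is e :: s' then exists r y, rspan s' y /\ x = iota r * e + y else x = 0.

Definition is_rsubmod (J : A -> Prop) : Prop :=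
  is_subgroup J /\ forall r x, J x -> J (iota r * x).

Lemma rspan_submod s : is_rsubmod (rspan s).
Proof.
elim: s => [|e s [[IH0 IHB] IHZ]] /=.
  by split; [split=> // _ _ -> ->; rewrite subrr|move=> r _ ->; rewrite mulr0].
split=> [|r x [r' [y [Hy ->]]]].
  split; first by exists 0, 0; rewrite rmorph0 mul0r addr0.
  move=> _ _ [r [y [Hy ->]]] [r' [y' [Hy' ->]]]; exists (r - r'), (y - y').
  by split; [exact: IHB|rewrite rmorphB; ring].
by exists (r * r'), (iota r * y); split; [exact: IHZ|rewrite rmorphM; ring].
Qed.

(** Finite generation of [J] within [rspan s], phrased through all submodules [Z] containing the
    generators. The induction removes one spanning element [e] at a time. *)
Lemma rspan_submodule_fg : noetherian R -> forall (s : seq A) (J : A -> Prop), is_rsubmod J ->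
  exists t : seq A, (forall x, x \in t -> J x) /\
    forall Z, is_rsubmod Z -> (forall x, x \in t -> Z x) ->
    forall x, J x -> rspan s x -> Z x.
Proof.
move=> noeth; elim=> [|e s IH] J HJ.
  by exists [::]; split=> // Z [[Z0 _] _] _ x _ /= ->.
have [[J0 JB] JZ] := HJ; have [[s0 sB] sZ] := rspan_submod s.
have [t [tJ tgen]] := IH J HJ.
(* The ideal of coefficients of [e] occurring in [Z]; for [J] it is finitely generated, and its
   generators are lifted to elements of [J]. *)
pose Q (Z : A -> Prop) : set R := fun r => exists y, rspan s y /\ Z (iota r * e + y).
have Qideal Z : is_rsubmod Z -> is_ideal (Q Z).
  move=> [ZG ZZ]; split.
  - by exists 0; split=> //; rewrite rmorph0 mul0r addr0; exact: subgroup0 ZG.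
  - move=> r r' [y [sy Zy]] [y' [sy' Zy']]; exists (y + y'); split.
      exact: (subgroupD (proj1 (rspan_submod s))).
    have -> : iota (r + r') * e + (y + y') = (iota r * e + y) + (iota r' * e + y').
      by rewrite rmorphD; ring.
    exact: subgroupD.
  - move=> a r [y [sy Zy]]; exists (iota a * y); split; first exact: sZ.
    have -> : iota (a * r) * e + iota a * y = iota a * (iota r * e + y).
      by rewrite rmorphM; ring.
    exact: ZZ.
have [rs rsE] := noeth _ (Qideal J HJ).
have rsQ r : r \in rs -> Q J r by rewrite rsE => rr; exact: mem_ideal_gen.
have [t' [t'J t'rs]] : exists t' : seq A, (forall x, x \in t' -> J x) /\
    forall Z : A -> Prop, (forall x, x \in t' -> Z x) -> forall r, r \in rs -> Q Z r.
  elim: (rs) rsQ => [|r rs' IHr] HQ; first by exists [::].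
  have [|t' [t'J t'rs]] := IHr; first by move=> x xr; apply: HQ; rewrite inE xr orbT.
  have [y [sy Jy]] := HQ r (mem_head _ _).
  exists ((iota r * e + y) :: t'); split=> [x|Z HZ x].
    by rewrite inE => /orP[/eqP->|/t'J].
  rewrite inE => /orP[/eqP->|]; first by exists y; split=> //; exact/HZ/mem_head.
  by apply: t'rs => x' x't; apply: HZ; rewrite inE x't orbT.
exists (t' ++ t); split=> [x|Z HZ tZ x Jx [r [y [sy xE]]]].
  by rewrite mem_cat => /orP[/t'J|/tJ].
have [ZG ZZ] := HZ.
(* Intersecting with [J] keeps the difference of [x] and its approximation in [J], where the
   induction hypothesis applies. *)
have ZJ : is_rsubmod (fun x => Z x /\ J x).
  split; first split=> [|u v [Zu Ju] [Zv Jv]]; [by split=> //; exact: subgroup0 ZG| |].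
    by split; [exact: (subgroupB ZG)|exact: JB].
  by move=> c u [Zu Ju]; split; [exact: ZZ|exact: JZ].
have : Q J r by exists y; rewrite -xE.
rewrite rsE => /(ideal_gen_sub (Qideal _ ZJ)) [].
  by apply: t'rs => u ut; split; [apply: tZ; rewrite mem_cat ut|exact: t'J].
move=> y' [sy' [Zy' Jy']].
have xy' : Z (x - (iota r * e + y')).
  apply: (tgen Z HZ) => [u ut||]; [by apply: tZ; rewrite mem_cat ut orbT|exact: JB|].
  by rewrite xE opprD addrACA subrr add0r; exact: sB.
by rewrite -(subrK (iota r * e + y') x); exact: subgroupD.
Qed.

Lemma noetherian_finite (s : seq A) : (forall x, rspan s x) -> noetherian R -> noetherian A.
Proof.
move=> sA noeth J HJ; have [J0 JD JM] := HJ.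
have subm I : is_ideal I -> is_rsubmod I.
  by move=> HI; split; [exact: ideal_subgroup|have [_ _ IM] := HI => r x; exact: IM].
have [t [tJ tgen]] := rspan_submodule_fg noeth s (subm _ HJ).
exists t; apply/seteqP; split=> x; last by apply: ideal_gen_sub => // y /tJ.
move=> Jx; apply: (tgen _ _ _ _ Jx (sA x)); first exact/subm/ideal_gen_ideal.
by move=> y yt; exact: mem_ideal_gen.
Qed.

Lemma rspan_sum (D : seq (A * A)) (F : A * A -> R) :
  rspan [seq d.1 | d <- D] (\sum_(d <- D) iota (F d) * d.1).
Proof.
elim: D => [|d D IH]; first by rewrite big_nil.
by rewrite big_cons /=; exists (F d), (\sum_(d <- D) iota (F d) * d.1).
Qed.

End NoetherianFinite.

(** * Localization of a Frobenius extension at a prime *)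

Section LocTheory.
Local Open Scope quotient_scope.
Variables (A : comNzRingType) (p : prime_idealr A).
Implicit Types x y : loc_pre p.

Lemma loc_addE x y : \pi_(loc p) x + \pi_(loc p) y = \pi_(loc p) (loc_preD x y).
Proof. by rewrite pi_locD. Qed.
Lemma loc_mulE x y : \pi_(loc p) x * \pi_(loc p) y = \pi_(loc p) (loc_preM x y).
Proof. by rewrite pi_locM. Qed.
Lemma loc_zeroE : 0 = \pi_(loc p) (loc_pre0 p).
Proof. by rewrite -[LHS]/(loc0 p) piE. Qed.
Lemma loc_oneE : 1 = \pi_(loc p) (loc_pre1 p).
Proof. by rewrite -[LHS]/(loc1 p) piE. Qed.
Lemma loc_zero s : \pi_(loc p) (0, s) = 0.
Proof. by rewrite loc_zeroE; apply: loc_pre_eq => /=; rewrite !mul0r. Qed.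
Lemma loc_add_same (a b : A) (s : loc_den p) :
  \pi_(loc p) (a, s) + \pi_(loc p) (b, s) = \pi_(loc p) (a + b, s).
Proof. by rewrite loc_addE; apply: loc_pre_eq => /=; ring. Qed.
Lemma loc_sum_same (T : Type) (r : seq T) (F : T -> A) (s : loc_den p) :
  \sum_(i <- r) \pi_(loc p) (F i, s) = \pi_(loc p) (\sum_(i <- r) F i, s).
Proof.
elim: r => [|i r IH]; first by rewrite !big_nil loc_zero.
by rewrite !big_cons IH loc_add_same.
Qed.
End LocTheory.

Section PrimePreimage.
Variables (R A : comNzRingType) (iota : {rmorphism R -> A}) (P : prime_idealr A).

Definition prime_preim : R -> bool := fun r => iota r \in P.

Lemma mem_prime_preim r : (r \in (prime_preim : {pred R})) = (iota r \in P).
Proof. by []. Qed.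

Lemma prime_preim_idealr : idealr_closed (prime_preim : {pred R}).
Proof.
split=> [||a x y xP yP]; rewrite mem_prime_preim; first by rewrite rmorph0 rpred0.
  by rewrite rmorph1 idealr1.
by rewrite rmorphD rmorphM rpredD ?idealMr.
Qed.
HB.instance Definition _ := isIdealr.Build R prime_preim prime_preim_idealr.

Lemma prime_preim_prime : prime_idealr_closed (prime_preim : {pred R}).
Proof. by move=> x y; rewrite !mem_prime_preim rmorphM prime_idealrM. Qed.
HB.instance Definition _ := isPrimeIdealrClosed.Build R prime_preim prime_preim_prime.

Definition preim_prime : prime_idealr R := prime_preim.

End PrimePreimage.

Section Localize.
Local Open Scope quotient_scope.
Variables (R A : comNzRingType) (iota : {rmorphism R -> A}) (phi : A -> R) (D : seq (A * A)).
Hypothesis phi_lin : forall r x y, phi (iota r * x + y) = r * phi x + phi y.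
Hypothesis dualD : forall a, a = \sum_(d <- D) iota (phi (a * d.2)) * d.1.
Variable P : prime_idealr A.
Hypothesis denP : forall s, s \notin P -> exists s' r, iota r \notin P /\ s * s' = iota r.

Lemma form0 : phi 0 = 0.
Proof.
have := phi_lin 1 0 0; rewrite mulr0 addr0 mul1r => /esym/(canRL (addrK _)).
by rewrite subrr.
Qed.

Local Notation p := (preim_prime iota P).

Definition loc_den_map (s : loc_den p) : loc_den P := exist _ (iota (sval s)) (svalP s).

Definition loc_map (c : loc p) : loc P :=
  \pi_(loc P) (iota (repr c).1, loc_den_map (repr c).2).

Lemma loc_map_pi x : loc_map (\pi_(loc p) x) = \pi_(loc P) (iota x.1, loc_den_map x.2).
Proof.
apply/eqmodP/loc_equivP; have [u pu e] := loc_pre_repr x.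
by exists (iota u) => //=; rewrite -!rmorphM e.
Qed.

Lemma loc_map_additive : zmod_morphism loc_map.
Proof.
move=> x y; have DD : {morph loc_map : x y / x + y}.
  elim/quotW=> {}x; elim/quotW=> {}y; rewrite loc_addE !loc_map_pi loc_addE.
  by apply: loc_pre_eq; rewrite /= !rmorphD !rmorphM.
by apply: (addIr (loc_map y)); rewrite -DD !subrK.
Qed.

Lemma loc_map_multiplicative : monoid_morphism loc_map.
Proof.
split; first by rewrite !loc_oneE loc_map_pi; apply: loc_pre_eq; rewrite /= !rmorph1.
elim/quotW=> x; elim/quotW=> y; rewrite loc_mulE !loc_map_pi loc_mulE.
by apply: loc_pre_eq; rewrite /= !rmorphM.
Qed.

HB.instance Definition _ := GRing.isZmodMorphism.Build (loc p) (loc P) loc_map loc_map_additive.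
HB.instance Definition _ := GRing.isMonoidMorphism.Build (loc p) (loc P) loc_map
  loc_map_multiplicative.

(** By [denP] a fraction can be expanded to have its denominator in R. *)
Lemma loc_normal_form (b : loc P) : {ar : A * loc_den p | b = \pi_(loc P) (ar.1, loc_den_map ar.2)}.
Proof.
apply: cid; elim/quotW: b => -[a [s sP]].
have [s' [r [rP E]]] := denP sP.
exists (a * s', exist _ r rP : loc_den p); apply: loc_pre_eq => /=.
by rewrite -E; ring.
Qed.

Definition loc_form (b : loc P) : loc p :=
  let ar := sval (loc_normal_form b) in \pi_(loc p) (phi ar.1, ar.2).

(** Independence of the chosen fraction: the factor [u] witnessing equality can be multiplied into
    the image of R, past which [phi] is linear. *)
Lemma loc_form_pi a (r : loc_den p) :
  loc_form (\pi_(loc P) (a, loc_den_map r)) = \pi_(loc p) (phi a, r).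
Proof.
rewrite /loc_form; case: (loc_normal_form _) => -[a1 r1] /= /eqmodP/loc_equivP[u uP /= E].
have [u' [w [wP uE]]] := denP uP.
have phiZ c x : phi (iota c * x) = c * phi x.
  by have := phi_lin c x 0; rewrite form0 !addr0.
apply/eqmodP/loc_equivP; exists w => //=.
have := congr1 (fun x => phi (u' * x)) E.
have -> : u' * (u * (a * iota (sval r1))) = iota (w * sval r1) * a.
  by rewrite rmorphM -uE; ring.
have -> : u' * (u * (a1 * iota (sval r))) = iota (w * sval r) * a1.
  by rewrite rmorphM -uE; ring.
by rewrite !phiZ => h; rewrite [phi a1 * _]mulrC [phi a * _]mulrC !mulrA h.
Qed.

Lemma loc_form_lin c x y : loc_form (loc_map c * x + y) = c * loc_form x + loc_form y.
Proof.
have [[a r] /= ->] := loc_normal_form x; have [[a' r'] /= ->] := loc_normal_form y.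
elim/quotW: c => -[r0 s0].
rewrite loc_map_pi !loc_form_pi !loc_mulE !loc_addE.
(* Common denominator; the trailing [+ 0] gives the numerator the shape for two uses of
   [phi_lin]. *)
have -> : \pi_(loc P) (loc_preD (loc_preM (iota r0, loc_den_map s0) (a, loc_den_map r))
     (a', loc_den_map r')) =
   \pi_(loc P) (iota (r0 * sval r') * a + (iota (sval s0 * sval r) * a' + 0),
     loc_den_map (loc_denM (loc_denM s0 r) r')).
  by apply: loc_pre_eq => /=; rewrite !rmorphM; ring.
rewrite loc_form_pi !phi_lin; apply: loc_pre_eq => /=.
by rewrite form0; ring.
Qed.

Definition loc_duals : seq (loc P * loc P) :=
  [seq (\pi_(loc P) (d.1, loc_den1 P), \pi_(loc P) (d.2, loc_den1 P)) | d <- D].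

Lemma loc_dual b : b = \sum_(d <- loc_duals) loc_map (loc_form (b * d.2)) * d.1.
Proof.
have [[a r] /= ->] := loc_normal_form b; rewrite big_map.
under eq_bigr => d _.
  rewrite /= loc_mulE.
  have -> : \pi_(loc P) (loc_preM (a, loc_den_map r) (d.2, loc_den1 P)) =
     \pi_(loc P) (a * d.2, loc_den_map r) by apply: loc_pre_eq => /=; ring.
  rewrite loc_form_pi loc_map_pi loc_mulE /=.
  have -> : \pi_(loc P) (loc_preM (iota (phi (a * d.2)), loc_den_map r) (d.1, loc_den1 P)) =
     \pi_(loc P) (iota (phi (a * d.2)) * d.1, loc_den_map r) by apply: loc_pre_eq => /=; ring.
  over.
by rewrite loc_sum_same -dualD.
Qed.

Lemma localized_injective_dimension :
  finite_injective_dimension (loc p)^o -> finite_injective_dimension (loc P)^o.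
Proof.
exact: (frobenius_injective_dimension (k := loc_map) loc_form_lin loc_dual).
Qed.

End Localize.

(** * The Gorenstein property *)

Section Gorenstein.
Local Open Scope quotient_scope.
Variables (R : comNzRingType) (m n : nat).
Local Notation N := (m.+1 + n.+1)%N.
Local Notation S := {mpoly R[N]}.
Local Notation L := (@link_ideal R m n).

Definition in_link : S -> bool := fun F => `[< L F >].

Lemma in_linkP F : reflect (L F) (F \in (in_link : {pred S})).
Proof. exact: asboolP. Qed.

Lemma in_link_idealr : idealr_closed (in_link : {pred S}).
Proof.
have [L0 LD LM] := @link_is_ideal R m n.
split=> [||a x y /in_linkP Lx /in_linkP Ly]; first exact/in_linkP.
  by apply/in_linkP; exact: link_proper.
by apply/in_linkP/LD => //; exact: LM.
Qed.
HB.instance Definition _ := isIdealr.Build S in_link in_link_idealr.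

Definition link_idealr : idealr S := in_link.
Local Notation Q := {ideal_quot link_idealr}.

Lemma quot_eqP F G : reflect (\pi_Q F = \pi_Q G) (F - G \in link_idealr).
Proof. by rewrite Quotient.idealrBE; exact: eqP. Qed.

Lemma quot_piM F G : \pi_Q (F * G) = \pi_Q F * \pi_Q G. Proof. exact: rmorphM. Qed.
Lemma quot_piD F G : \pi_Q (F + G) = \pi_Q F + \pi_Q G. Proof. exact: rmorphD. Qed.
Lemma quot_piB F G : \pi_Q (F - G) = \pi_Q F - \pi_Q G. Proof. exact: rmorphB. Qed.
Lemma quot_piX F k : \pi_Q (F ^+ k) = \pi_Q F ^+ k. Proof. exact: rmorphXn. Qed.

Definition quot_iota (r : R) : Q := \pi_Q (r%:MP : S).

Lemma quot_iota_additive : zmod_morphism quot_iota.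
Proof. by move=> x y; rewrite /quot_iota mpolyCB rmorphB. Qed.
Lemma quot_iota_multiplicative : monoid_morphism quot_iota.
Proof. by split=> [|x y]; rewrite /quot_iota ?mpolyC1 ?rmorph1 // mpolyCM rmorphM. Qed.
HB.instance Definition _ := GRing.isZmodMorphism.Build R Q quot_iota quot_iota_additive.
HB.instance Definition _ := GRing.isMonoidMorphism.Build R Q quot_iota quot_iota_multiplicative.

Definition quot_form (a : Q) : R := res_form (repr a).

Lemma quot_form_pi F : quot_form (\pi_Q F) = res_form F.
Proof.
apply/eqP; rewrite /quot_form -subr_eq0 -raddfB /=.
have /quot_eqP/in_linkP H : \pi_Q (repr (\pi_Q F)) = \pi_Q F by rewrite reprK.
by rewrite -[X in res_form X]mulr1 (res_form_link _ H).
Qed.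

Lemma quot_form_lin r x y : quot_form (quot_iota r * x + y) = r * quot_form x + quot_form y.
Proof.
elim/quotW: x => F; elim/quotW: y => G.
by rewrite /quot_iota -quot_piM -quot_piD !quot_form_pi mul_mpolyC linearP.
Qed.

Lemma quot_duality : exists D, forall a : Q,
  a = \sum_(d <- D) quot_iota (quot_form (a * d.2)) * d.1.
Proof.
have [D HD] := perfect_duality R m n.
exists [seq (\pi_Q d.1, \pi_Q d.2) | d <- D]; elim/quotW => F; rewrite big_map.
transitivity (\pi_Q (duals D F)); first by apply/quot_eqP/in_linkP.
rewrite rmorph_sum; apply: eq_bigr => d _ /=.
by rewrite -(quot_piM F d.2) quot_form_pi /quot_iota -quot_piM mul_mpolyC.
Qed.

Lemma prime_idealX (A : comNzRingType) (P : prime_idealr A) x k : x ^+ k \in P -> x \in P.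
Proof.
elim: k => [|k IH]; first by rewrite expr0 idealr1.
by rewrite exprS prime_idealrM => /orP[|/IH].
Qed.

(** [F] and its constant term differ by a nilpotent, which lies in every prime, so the constant term
    is outside [P] as well; by [constant_term_power], [F] divides a power of it. *)
Lemma quot_denominators (P : prime_idealr Q) s : s \notin P ->
  exists s' r, quot_iota r \notin P /\ s * s' = quot_iota r.
Proof.
elim/quotW: s => F FP.
have [G /in_linkP/quot_eqP E] := constant_term_power F.
exists (\pi_Q G), (constant_term F ^+ (n + m).+1); split; last by rewrite -quot_piM E.
apply: contra FP; rewrite rmorphXn => /prime_idealX cP.
rewrite -(subrK (quot_iota (constant_term F)) (\pi_Q F)) rpredD //.
apply: (@prime_idealX _ _ _ (n + m).+1); rewrite -quot_piB -quot_piX.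
have -> : \pi_Q ((F - (constant_term F)%:MP) ^+ (n + m).+1) = \pi_Q 0.
  by apply/quot_eqP; rewrite subr0; apply/in_linkP; exact: nilpotent_mod_link.
by rewrite rmorph0 rpred0.
Qed.

Lemma link_gorenstein : gorenstein_ring R -> gorenstein_ideal L.
Proof.
move=> [noeth injdim]; have [D HD] := quot_duality.
exists link_idealr; first by apply/seteqP; split=> F /in_linkP.
split=> [|P].
  apply: (noetherian_finite (iota := quot_iota) (s := [seq d.1 | d <- D])) noeth => a.
  by rewrite [a]HD; exact: rspan_sum.
apply: (localized_injective_dimension quot_form_lin HD (@quot_denominators P)).
exact: injdim.
Qed.

End Gorenstein.

Theorem theorem6 (R : idomainType) (m n : nat) :
  noetherian R ->
  let f := generic_f R m n in
  let g := generic_g R m n in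
  let L := ideal_add (ideal_add (content (f * g)) (ideal_exp (content f) n.+1))
                     (ideal_exp (content g) m.+1) in
  [/\ content (f * g) = content f `&` content g `&` L,
      primary_ideal (content f),
      primary_ideal (content g)
    & primary_ideal L]
  /\ (gorenstein_ring R -> gorenstein_ideal L).
Proof.
move=> _ f g L; split; last exact: link_gorenstein.
split; last exact: link_primary.
- apply/seteqP; split=> F; last by move=> [[Ff Fg] FL]; exact: content_decomposition.
  move=> FC; split; last exact: content_link.
  by split; [exact: content_mull FC|apply: (content_mull (F2 := f)); rewrite mulrC].
- exact: (primary_retract (content_ideal f) (@kill_x_content R m n) (@kill_x_retract R m n)).
- exact: (primary_retract (content_ideal g) (@kill_y_content R m n) (@kill_y_retract R m n)).
Qed.
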